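(* Let $\hat K\cong I_{2,10}$, let $\Gamma=\operatorname{Aut}\hat K$ be its isometry group, let $\mathcal{D}\subset P(\hat K\otimes\mathbb{C})$ be the set of points having a representative vector $v$ with $\langle v|v\rangle=0$ and $\langle v|\bar v\rangle>0$, and let $\overline{\mathcal{D}/\Gamma}$ be the Satake compactification of $\mathcal{D}/\Gamma$. (1) There are exactly two $\Gamma$-orbits of primitive isotropic vectors $v$ in $\hat K$, one with $v^\perp/\langle v\rangle\cong I_{1,9}$ and one with $v^\perp/\langle v\rangle\cong II_{1,9}$ (here $\langle v\rangle$ is the span of $v$); these correspond to the two $0$-dimensional boundary components of $\overline{\mathcal{D}/\Gamma}$. (2) There are exactly two $\Gamma$-orbits of $2$-dimensional primitive isotropic sublattices $V$ in $\hat K$, one with $V^\perp/V\cong E_8(-1)$ and one with $V^\perp/V\cong I_{0,8}$; these correspond to the two $1$-dimensional boundary components of $\overline{\mathcal{D}/\Gamma}$.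
   Context: A lattice is a free $\mathbb{Z}$-module of finite rank with a symmetric bilinear form $\langle\,|\,\rangle$; the norm of $v$ is $\langle v|v\rangle$. $I_{p,m}$ is the lattice with an orthogonal basis of $p$ vectors of norm $+1$ and $m$ vectors of norm $-1$. $II_{1,9}$ is the unique even unimodular lattice of signature $(1,9)$. $E_8$ is the positive definite even unimodular lattice of rank 8, and $E_8(-1)$ is the same lattice with all inner products negated. A primitive isotropic vector is a nonzero primitive vector of norm $0$; an isotropic sublattice is one on which the bilinear form vanishes identically, and a sublattice $V\subset\hat K$ is primitive if $\hat K/V$ is torsion-free. Orthogonal complements are taken in $\hat K$. The bilinear form is extended $\mathbb{C}$-bilinearly to $\hat K\otimes\mathbb{C}$, so that $\mathcal{D}$ is the Hermitian symmetric space for $O(2,10)$. The Satake compactification $\overline{\mathcal{D}/\Gamma}$ (also called the Satake–Baily–Borel compactification) is defined in terms of the isotropic sublattices of $\hat K$: it is the quotient by $\Gamma$ of the union of $\mathcal{D}$ with its rational boundary components; its $0$-dimensional (respectively $1$-dimensional) boundary components correspond to the $\Gamma$-orbits of primitive isotropic sublattices of $\hat K$ of rank 1 (respectively rank 2), a sublattice $V$ corresponding to the boundary component of $\mathcal{D}$ lying in $P(V\otimes\mathbb{C})$. *)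

(* Defs.v *)
From HB Require Import structures.
From mathcomp Require Import all_boot all_order all_algebra.
From mathcomp Require Import boolp classical_sets functions cardinality reals.
From mathcomp Require Import complex.

Set Implicit Arguments.
Unset Strict Implicit.
Unset Printing Implicit Defensive.

Import Order.TTheory GRing.Theory Num.Theory.
Local Open Scope ring_scope.
Local Open Scope quotient_scope.
Local Open Scope classical_set_scope.

(* A Z-module with an integer valued pairing.  Freeness is not part of the
   structure, so that lattices and the quotients V^perp / V are both instances. *)
Record zform := Zform { zcar :> zmodType ; zbil : zcar -> zcar -> int }.

Notation "<| x , y |>" := (zbil x y) (at level 0, x, y at level 99).

(* A lattice is a free Z-module with a chosen basis: coordinates are row
   vectors, and the symmetric bilinear form is given by its Gram matrix.  The
   choice of a basis gives K (x) S the model 'rV[S]_n for every ring S. *)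
Record lattice := Lattice {
  lrank : nat ;
  gram : 'M[int]_lrank ;
  gram_sym : gram^T = gram }.

Definition lattice_zform (L : lattice) : zform :=
  @Zform 'rV[int]_(lrank L) (fun x y => (x *m gram L *m y^T) 0 0).
Coercion lattice_zform : lattice >-> zform.

Definition isometry (A B : zform) (g : A -> B) : Prop :=
  [/\ {morph g : x y / x + y}, bijective g
    & forall x y, <| g x, g y |> = <| x, y |>].

Definition isometric (A B : zform) : Prop := exists g : A -> B, isometry g.

Definition isometry_group (K : lattice) : set (K -> K) := [set g | isometry g].
Arguments isometry_group : clear implicits.

Lemma Ipm_sym (p m : nat) :
  let G := diag_mx (row_mx (const_mx 1) (const_mx (-1)) : 'rV[int]_(p + m)) in
  G^T = G.
Proof. exact: tr_diag_mx. Qed.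
Definition Ipm (p m : nat) : lattice := Lattice (Ipm_sym p m).

(* Edges of the E_8 Dynkin diagram, nodes 0..7 in Bourbaki's order:
   0 - 2 - 3 - 4 - 5 - 6 - 7, with the node 1 attached to 3. *)
Definition E8_edges : seq (nat * nat) :=
  [:: (0, 2); (2, 3); (3, 4); (4, 5); (5, 6); (6, 7); (1, 3)]%N.

Definition E8_coef (i j : nat) : int :=
  if i == j then 2
  else if ((i, j) \in E8_edges) || ((j, i) \in E8_edges) then -1 else 0.

Lemma E8_sym : let G := \matrix_(i < 8, j < 8) E8_coef i j in G^T = G.
Proof. by apply/matrixP => i j; rewrite !mxE /E8_coef orbC eq_sym. Qed.
Definition E8 : lattice := Lattice E8_sym.

Lemma neg_sym (L : lattice) : (- gram L)^T = - gram L.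
Proof. by rewrite linearN /= gram_sym. Qed.
(* L(-1) *)
Definition lattice_neg (L : lattice) : lattice := Lattice (neg_sym L).

Lemma dsum_sym (L M : lattice) :
  let G := block_mx (gram L) 0 0 (gram M) in G^T = G.
Proof. by rewrite /= tr_block_mx !gram_sym !trmx0. Qed.
Definition lattice_sum (L M : lattice) : lattice := Lattice (dsum_sym L M).

Lemma U_sym : let G := \matrix_(i < 2, j < 2) (i != j)%:R : 'M[int]_2 in G^T = G.
Proof. by apply/matrixP => i j; rewrite !mxE eq_sym. Qed.
Definition hyperbolic_plane : lattice := Lattice U_sym.

(* The standard model of the unique even unimodular lattice of signature
   (1,9); see [II_1_9_spec]. *)
Definition II_1_9 : lattice := lattice_sum hyperbolic_plane (lattice_neg E8).

Definition even_lattice (L : lattice) : Prop :=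
  forall x : L, (2 %| <| x, x |>)%Z.

Definition unimodular (L : lattice) : Prop := gram L \in unitmx.

(* L has an orthogonal family of full rank (the rows of P), p vectors of which
   have positive norm and m negative norm. *)
Definition has_signature (L : lattice) (p m : nat) : Prop :=
  exists (P : 'M[int]_(lrank L)) (d : 'rV[int]_(lrank L)),
  [/\ P *m gram L *m P^T = diag_mx d,
      #|[pred i | 0 < d 0 i]| = p, #|[pred i | d 0 i < 0]| = m
    & lrank L = (p + m)%N].

(* The rest of this part checks that E8 and II_1_9 are even and unimodular, of
   signature (8,0) and (1,9). *)

Lemma even_gram (L : lattice) (M : 'M_(lrank L)) :
  gram L = M + M^T -> even_lattice L.
Proof.
move=> e x; rewrite /= e mulmxDr mulmxDl mxE.
have -> : x *m M^T *m x^T = (x *m M *m x^T)^T.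
  by rewrite !trmx_mul trmxK mulmxA.
by rewrite [_^T 0 0]mxE -mulr2n -(mulr_natr ((x *m M *m x^T) 0 0)) dvdz_mull.
Qed.

(* Multiplication of explicit matrices, reduced to computation *)
Definition mul_coef (n : nat) (A B : nat -> nat -> int) (i j : nat) : int :=
  foldr (fun k s => A i k * B k j + s) 0 (iota 0 n).

Lemma mulmx_coef (n : nat) (A B : nat -> nat -> int) :
  (\matrix_(i < n, j < n) A i j) *m (\matrix_(i < n, j < n) B i j) =
  \matrix_(i < n, j < n) mul_coef n A B i j.
Proof.
apply/matrixP => i j; rewrite !mxE /mul_coef.
under eq_bigr do rewrite !mxE.
rewrite -(big_mkord xpredT (fun k => A i k * B k j)) /index_iota subn0.
by elim: (iota 0 n) => [|k s IH]; rewrite ?big_nil ?big_cons //= IH.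
Qed.

Lemma eq_mx_coef (n : nat) (A B : nat -> nat -> int) :
  all (fun i => all (fun j => A i j == B i j) (iota 0 n)) (iota 0 n) ->
  (\matrix_(i < n, j < n) A i j) = \matrix_(i < n, j < n) B i j.
Proof.
move=> /allP AB; apply/matrixP => i j; rewrite !mxE; apply/eqP.
have /AB/allP : (i : nat) \in iota 0 n by rewrite mem_iota /=.
by apply; rewrite mem_iota /=.
Qed.

Definition coef_of (s : seq (seq int)) (i j : nat) : int := nth 0 (nth [::] s i) j.

Definition E8_inv : seq (seq int) :=
  [:: [:: 4; 5; 7; 10; 8; 6; 4; 2]; [:: 5; 8; 10; 15; 12; 9; 6; 3];
      [:: 7; 10; 14; 20; 16; 12; 8; 4]; [:: 10; 15; 20; 30; 24; 18; 12; 6];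
      [:: 8; 12; 16; 24; 20; 15; 10; 5]; [:: 6; 9; 12; 18; 15; 12; 8; 4];
      [:: 4; 6; 8; 12; 10; 8; 6; 3]; [:: 2; 3; 4; 6; 5; 4; 3; 2]].

(* An orthogonal family of vectors of E8, and their norms *)
Definition E8_orth : seq (seq int) :=
  [:: [:: 1; 0; 0; 0; 0; 0; 0; 0]; [:: 0; 1; 0; 0; 0; 0; 0; 0];
      [:: 1; 0; 2; 0; 0; 0; 0; 0]; [:: 2; 3; 4; 6; 0; 0; 0; 0];
      [:: 2; 3; 4; 6; 5; 0; 0; 0]; [:: 2; 3; 4; 6; 5; 4; 0; 0];
      [:: 2; 3; 4; 6; 5; 4; 3; 0]; [:: 2; 3; 4; 6; 5; 4; 3; 2]].
Definition E8_norms : seq int := [:: 2; 2; 6; 30; 20; 12; 6; 2].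

Lemma E8_even : even_lattice E8.
Proof.
pose c i j := if i == j :> nat then 1 else if (i < j)%N then E8_coef i j else 0.
pose M := \matrix_(i < 8, j < 8) c i j.
suff e : gram E8 = M + M^T by exact: even_gram e.
transitivity (\matrix_(i < 8, j < 8) (c i j + c j i)); last first.
  by apply/matrixP => i j; rewrite !mxE.
exact: (@eq_mx_coef 8 E8_coef (fun i j => c i j + c j i)).
Qed.

Lemma E8_unimodular : unimodular E8.
Proof.
suff: gram E8 *m \matrix_(i < 8, j < 8) coef_of E8_inv i j = 1%:M.
  by move=> /mulmx1_unit[].
rewrite mulmx_coef; transitivity (\matrix_(i < 8, j < 8) ((i == j :> nat)%:R : int)).
  exact: (eq_mx_coef (B := fun i j => (i == j)%:R)).
by apply/matrixP => i j; rewrite !mxE.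
Qed.

Lemma E8_signature : has_signature E8 8 0.
Proof.
pose d : 'rV[int]_8 := \row_j nth 0 E8_norms j.
have d_gt0 i : 0 < d 0 i.
  by rewrite mxE; case: i => [] [|[|[|[|[|[|[|[|]]]]]]]].
pose P := \matrix_(i < 8, j < 8) coef_of E8_orth i j.
have PE : P *m (\matrix_(i < 8, j < 8) E8_coef i j) *m P^T = diag_mx d.
  have -> : P^T = \matrix_(i < 8, j < 8) coef_of E8_orth j i.
    by apply/matrixP => i j; rewrite !mxE.
  rewrite mulmx_coef (mulmx_coef _ _ (fun i j => coef_of E8_orth j i)).
  transitivity (\matrix_(i < 8, j < 8) (nth 0 E8_norms i *+ (i == j :> nat))).
    exact: (eq_mx_coef (B := fun i j => nth 0 E8_norms i *+ (i == j))).
  by apply/matrixP => i j; rewrite !mxE.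
exists P, d; split => //.
- by rewrite -[RHS]card_ord; apply: eq_card => i; rewrite !inE d_gt0.
- by apply: eq_card0 => i; rewrite !inE ltNge ltW ?d_gt0.
Qed.

Lemma neg_even (L : lattice) : even_lattice L -> even_lattice (lattice_neg L).
Proof. by move=> eL x; rewrite /= mulmxN mulNmx mxE rpredN; apply: eL. Qed.

Lemma neg_unimodular (L : lattice) : unimodular L -> unimodular (lattice_neg L).
Proof. by rewrite /unimodular /= -scaleN1r unitmxZ ?unitrN1. Qed.

Lemma neg_signature (L : lattice) (p m : nat) :
  has_signature L p m -> has_signature (lattice_neg L) m p.
Proof.
move=> [P [d [e dp dm r]]]; exists P, (- d); split; rewrite /= ?[(m + p)%N]addnC //.
- by rewrite mulmxN mulNmx e linearN.
- by rewrite -dm; apply: eq_card => i; rewrite !inE mxE oppr_gt0.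
- by rewrite -dp; apply: eq_card => i; rewrite !inE mxE oppr_lt0.
Qed.

Lemma dsum_even (L M : lattice) :
  even_lattice L -> even_lattice M -> even_lattice (lattice_sum L M).
Proof.
move=> eL eM x; rewrite /= -[x in x *m _ *m _]hsubmxK -[x in _ *m x^T]hsubmxK.
rewrite tr_row_mx mul_row_block !mulmx0 addr0 add0r mul_row_col mxE.
by rewrite rpredD //; [apply: eL | apply: eM].
Qed.

Lemma dsum_unimodular (L M : lattice) :
  unimodular L -> unimodular M -> unimodular (lattice_sum L M).
Proof. by move=> uL uM; rewrite /unimodular unitmxE det_ublock unitrM -!unitmxE uL. Qed.

Lemma dsum_signature (L M : lattice) (p m q n : nat) :
  has_signature L p m -> has_signature M q n ->
  has_signature (lattice_sum L M) (p + q) (m + n).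
Proof.
move=> [P [d [eP dp dm rL]]] [Q [f [eQ fq fn rM]]].
exists (block_mx P 0 0 Q), (row_mx d f); split; last 1 first.
- by rewrite /= rL rM addnACA.
- rewrite tr_block_mx !mulmx_block !trmx0 !(mulmx0, mul0mx, addr0, add0r).
  by rewrite eP eQ diag_mx_row.
- rewrite -dp -fq -!sum1_card big_split_ord /=.
  by congr addn; apply: eq_bigl => i; rewrite !inE (row_mxEl, row_mxEr).
- rewrite -dm -fn -!sum1_card big_split_ord /=.
  by congr addn; apply: eq_bigl => i; rewrite !inE (row_mxEl, row_mxEr).
Qed.

Lemma hyperbolic_plane_spec : [/\ even_lattice hyperbolic_plane,
  unimodular hyperbolic_plane & has_signature hyperbolic_plane 1 1].
Proof.
pose u (i j : nat) : int := (i != j)%:R.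
split.
- suff e : gram hyperbolic_plane = (\matrix_(i < 2, j < 2) ((i < j)%N%:R : int))
      + (\matrix_(i < 2, j < 2) ((i < j)%N%:R : int))^T by exact: even_gram e.
  by apply/matrixP => i j; rewrite !mxE -natrD neq_ltn; case: ltngtP.
- suff: gram hyperbolic_plane *m gram hyperbolic_plane = 1%:M by case/mulmx1_unit.
  transitivity (\matrix_(i < 2, j < 2) mul_coef 2 u u i j).
    exact: (mulmx_coef 2 u u).
  transitivity (\matrix_(i < 2, j < 2) ((i == j :> nat)%:R : int)).
    exact: (eq_mx_coef (B := fun i j => (i == j)%:R)).
  by apply/matrixP => i j; rewrite !mxE.
pose c (i j : nat) : int := if (i == 1)%N && (j == 1)%N then -1 else 1.
pose d : 'rV[int]_2 := \row_j (if j == 0 :> nat then 2 else -2).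
pose P := \matrix_(i < 2, j < 2) c i j.
have PE : P *m (\matrix_(i < 2, j < 2) u i j) *m P^T = diag_mx d.
  have -> : P^T = P by apply/matrixP => i j; rewrite !mxE /c andbC.
  rewrite !mulmx_coef.
  transitivity (\matrix_(i < 2, j < 2)
    ((if i == 0 :> nat then 2 else -2) *+ (i == j :> nat) : int)).
    exact: (eq_mx_coef (B := fun i j => (if i == 0 then 2 else -2) *+ (i == j))).
  by apply/matrixP => i j; rewrite !mxE.
exists P, d; split => //.
- apply: (etrans _ (card1 (0 : 'I_2))); apply: eq_card => i.
  by rewrite !inE mxE; case: i => [[|[]]].
- apply: (etrans _ (card1 (1 : 'I_2))); apply: eq_card => i.
  by rewrite !inE mxE; case: i => [[|[]]].
Qed.

Lemma E8_spec : [/\ even_lattice E8, unimodular E8 & has_signature E8 8 0].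
Proof. by split; [exact: E8_even|exact: E8_unimodular|exact: E8_signature]. Qed.

Lemma II_1_9_spec :
  [/\ even_lattice II_1_9, unimodular II_1_9 & has_signature II_1_9 1 9].
Proof.
have [eE uE sE] := E8_spec; have [eU uU sU] := hyperbolic_plane_spec.
split; first by apply: dsum_even => //; apply: neg_even.
  by apply: dsum_unimodular => //; apply: neg_unimodular.
apply: (@dsum_signature hyperbolic_plane (lattice_neg E8) 1 1 0 8) => //.
exact: neg_signature.
Qed.

Record sublattice (K : lattice) := Sublattice {
  sl_pred : K -> bool ;
  sl_closed : zmod_closed sl_pred }.
Canonical sublattice_predType (K : lattice) :=
  PredType (@sl_pred K).

Definition isotropic_sublattice (K : lattice) (V : sublattice K) : Prop :=
  {in V &, forall x y, <| x, y |> = 0}.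

(* K / V is torsion-free *)
Definition primitive_sublattice (K : lattice) (V : sublattice K) : Prop :=
  forall (k : int) (x : K), k != 0 -> x *~ k \in V -> x \in V.

(* V has a basis of r elements, the rows of b *)
Definition has_rank (K : lattice) (V : sublattice K) (r : nat) : Prop :=
  exists b : 'M[int]_(r, lrank K),
    (forall c : 'rV[int]_r, c *m b = 0 -> c = 0) /\
    (forall x : K, x \in V <-> exists c : 'rV[int]_r, x = c *m b).

Definition primitive_isotropic_vector (K : lattice) : set K :=
  [set v | [/\ v != 0, <| v, v |> = 0
             & forall (k : int) (w : K), v = w *~ k -> `|k| = 1]].
Arguments primitive_isotropic_vector : clear implicits.

Definition span_pred (K : lattice) (v : K) : {pred K} :=
  fun x => `[< exists k : int, x = v *~ k >].

Lemma span_closed (K : lattice) (v : K) : zmod_closed (span_pred v).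
Proof.
split=> [|x y]; first by apply/asboolP; exists 0; rewrite mulr0z.
move=> /asboolP[k ->] /asboolP[l ->]; apply/asboolP; exists (k - l).
by rewrite mulrzBr.
Qed.
Definition zspan (K : lattice) (v : K) : sublattice K := Sublattice (span_closed v).

Lemma lformB (K : lattice) (x y z : K) : <| x - y, z |> = <| x, z |> - <| y, z |>.
Proof. by rewrite /= !mulmxBl !mxE. Qed.

Lemma lformC (K : lattice) (x y : K) : <| x, y |> = <| y, x |>.
Proof.
have /= -> : x *m gram K *m y^T = (y *m gram K *m x^T)^T.
  by rewrite !trmx_mul trmxK gram_sym mulmxA.
by rewrite mxE.
Qed.

Definition perp (K : lattice) (V : sublattice K) : {pred K} :=
  fun x => `[< {in V, forall y, <| x, y |> = 0} >].

Lemma perp_closed (K : lattice) (V : sublattice K) : zmod_closed (perp V).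
Proof.
split=> [|x y /asboolP px /asboolP py].
  by apply/asboolP => y _; rewrite /= !mul0mx mxE.
by apply/asboolP => z Vz; rewrite lformB px // py // subrr.
Qed.
HB.instance Definition _ (K : lattice) (V : sublattice K) :=
  GRing.isZmodClosed.Build K (perp V) (perp_closed V).

Definition perp_type (K : lattice) (V : sublattice K) : Type :=
  {x : K | x \in perp V}.
HB.instance Definition _ (K : lattice) (V : sublattice K) :=
  SubChoice.on (perp_type V).
HB.instance Definition _ (K : lattice) (V : sublattice K) :=
  [SubChoice_isSubZmodule of perp_type V by <:].

Definition in_perp (K : lattice) (V : sublattice K) : {pred perp_type V} :=
  fun x => val x \in V.

Lemma in_perp_closed (K : lattice) (V : sublattice K) : zmod_closed (@in_perp K V).
Proof.
have [V0 VB] := sl_closed V.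
by split=> [|x y Vx Vy]; rewrite unfold_in /in_perp ?raddf0 ?raddfB //=; exact: VB.
Qed.
HB.instance Definition _ (K : lattice) (V : sublattice K) :=
  GRing.isZmodClosed.Build (perp_type V) (@in_perp K V) (@in_perp_closed K V).

Definition perp_quot_type (K : lattice) (V : sublattice K) : zmodType :=
  Quotient.quot (@in_perp K V : zmodClosed (perp_type V)).

(* V^perp / V for isotropic V (in general V^perp / (V :&: V^perp)), with the
   form induced by that of K; see [perp_quotE]. *)
Definition perp_quot (K : lattice) (V : sublattice K) : zform :=
  @Zform (perp_quot_type V)
    (fun x y => <| val (repr x) : K, val (repr y) : K |>).

Lemma perp_quotE (K : lattice) (V : sublattice K) (x y : perp_type V) :
  <| \pi_(Quotient.quot (@in_perp K V)) x : perp_quot V,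
     \pi_(Quotient.quot (@in_perp K V)) y : perp_quot V |>
  = <| val x : K, val y : K |>.
Proof.
have piV z : val (repr (\pi_(Quotient.quot (@in_perp K V)) z)) - val z \in V.
  have : repr (\pi_(Quotient.quot (@in_perp K V)) z) - z \in @in_perp K V.
    by rewrite Quotient.idealrBE reprK.
  by rewrite unfold_in /in_perp raddfB.
have perpE z (w : perp_type V) : z \in V -> <| z, val w : K |> = 0.
  by move=> Vz; rewrite lformC; have /asboolP := valP w; apply.
have formE z t (w : perp_type V) : z - t \in V ->
    <| z, val w : K |> = <| t, val w : K |>.
  by move=> Vzt; apply/eqP; rewrite -subr_eq0 -lformB perpE.
change (<| val (repr (\pi_(Quotient.quot (@in_perp K V)) x)) : K,
  val (repr (\pi_(Quotient.quot (@in_perp K V)) y)) : K |> = <| val x : K, val y : K |>).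
by rewrite (formE _ _ _ (piV x)) lformC (formE _ _ _ (piV y)) lformC.
Qed.

(* V (x) S as a subset of K (x) S = 'rV[S]_n: finite S-linear combinations of
   elements of V, the rows of b. *)
Definition scalar_ext (S : pzRingType) (K : lattice) (V : sublattice K) :
    set 'rV[S]_(lrank K) :=
  [set w | exists (r : nat) (b : 'M[int]_(r, lrank K)) (c : 'rV[S]_r),
     (forall i, row i b \in V) /\ w = c *m map_mx intr b].
Arguments scalar_ext S {K} V.

(* The C-bilinear extension of the form of K to K (x) C, C = R[i]. *)
Definition cform (R : realType) (K : lattice) (x y : 'rV[R[i]]_(lrank K)) : R[i] :=
  (x *m map_mx intr (gram K) *m y^T) 0 0.

(* Points of P(K (x) C) are the lines of K (x) C. *)
Definition proj_point (R : realType) (K : lattice) : Type :=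
  {vspace 'rV[R[i]]_(lrank K)}.

Definition proj_space (R : realType) (K : lattice) (W : set 'rV[R[i]]_(lrank K)) :
    set (proj_point R K) :=
  [set p | \dim p = 1%N /\ forall w, w \in p -> W w].

Definition period_domain (R : realType) (K : lattice) : set (proj_point R K) :=
  [set p | proj_space setT p /\ exists v : 'rV[R[i]]_(lrank K),
     [/\ p = <[v]>%VS, cform v v = 0 & 0 < cform v (map_mx conjc v)]].
Arguments period_domain : clear implicits.

(* The boundary component of the domain lying in P(V (x) C): the points [v] of
   P(V (x) C) such that Re v and Im v span V (x) R.  For V of rank 1 this is
   the single point P(V (x) C); for V of rank 2 it is the projective line
   P(V (x) C) minus its real points P(V (x) R), i.e. two half-planes, one for
   each connected component of the domain. *)
Definition domain_boundary (R : realType) (K : lattice) (V : sublattice K) :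
    set (proj_point R K) :=
  [set p | proj_space (scalar_ext R[i] V) p /\ exists v : 'rV[R[i]]_(lrank K),
     p = <[v]>%VS /\
     scalar_ext R V = [set u | exists a b : R,
       u = a *: map_mx (@complex.Re R) v + b *: map_mx (@complex.Im R) v]].
Arguments domain_boundary R {K} V.

Definition extended_domain (R : realType) (K : lattice) : set (proj_point R K) :=
  period_domain R K `|`
  \bigcup_(V in [set V : sublattice K |
                    primitive_sublattice V /\ isotropic_sublattice V])
    domain_boundary R V.
Arguments extended_domain : clear implicits.

(* The action of g : K -> K on P(K (x) C). *)
Definition proj_act (R : realType) (K : lattice) (g : K -> K) (p : proj_point R K) :
    proj_point R K :=
  let M : 'M[int]_(lrank K) := lin1_mx (g : 'rV_(lrank K) -> 'rV_(lrank K)) in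
  (linfun (mulmxr (map_mx intr M : 'M[R[i]]_(lrank K))) @: p)%VS.

Definition point_orbit (R : realType) (K : lattice) (p : proj_point R K) :
    set (proj_point R K) :=
  [set proj_act g p | g in isometry_group K].

(* The Satake compactification of the quotient of the domain by the isometry
   group of K, as a set: the orbits of this group in the extended domain. *)
Definition satake (R : realType) (K : lattice) : set (set (proj_point R K)) :=
  [set point_orbit p | p in extended_domain R K].
Arguments satake : clear implicits.

(* The image in the Satake compactification of the boundary component
   attached to V. *)
Definition satake_boundary (R : realType) (K : lattice) (V : sublattice K) :
    set (set (proj_point R K)) :=
  satake R K `&` [set point_orbit p | p in domain_boundary R V].
Arguments satake_boundary R {K} V.

(* The k-dimensional boundary components: P(V (x) C) has dimension k, that is
   V has rank k + 1. *)
Definition boundary_components (R : realType) (K : lattice) (k : nat) :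
    set (set (set (proj_point R K))) :=
  [set satake_boundary R V | V in
     [set V : sublattice K |
       [/\ primitive_sublattice V, isotropic_sublattice V & has_rank V k.+1]]].
Arguments boundary_components : clear implicits.

Definition vector_orbit (K : lattice) (v : K) : set K :=
  [set g v | g in isometry_group K].

Definition sublattice_orbit (K : lattice) (V : sublattice K) :
    set (sublattice K) :=
  [set W : sublattice K | exists2 g, isometry_group K g & [set` W] = g @` [set` V]].

Definition primitive_isotropic_plane (K : lattice) : set (sublattice K) :=
  [set V | [/\ primitive_sublattice V, isotropic_sublattice V & has_rank V 2]].
Arguments primitive_isotropic_plane : clear implicits.

Definition isotropic_vector_orbits (K : lattice) : set (set K) :=
  [set vector_orbit v | v in primitive_isotropic_vector K].
Arguments isotropic_vector_orbits : clear implicits.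

Definition isotropic_plane_orbits (K : lattice) : set (set (sublattice K)) :=
  [set sublattice_orbit V | V in primitive_isotropic_plane K].
Arguments isotropic_plane_orbits : clear implicits.

(* Main.v *)
(* Identify K with I_{2,10}.  Its primitive isotropic vectors v are moved by
   Eichler transvections x |-> x - <m|x> e + <e|x> m - (<m|m>/2) <e|x> e along
   two orthogonal hyperbolic planes.  A Euclidean descent makes v orthogonal to
   the second plane U' = <e', f'>; one transvection along e' then gives v
   intersection number 1 or 2 with f', according as v is not or is
   characteristic, and one along f' brings it to a fixed vector.  So the orbit
   of v is decided by whether v is characteristic.

   Let V be a primitive isotropic plane.  The members of a basis of V are not
   both characteristic, as their difference would be divisible by 2.  Moving a
   noncharacteristic one to a = (1; 1) in I_{1,1} + I_{1,9} gives V = <a, u>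
   with u primitive isotropic in I_{1,9}.  Vinberg's reduction by reflections
   takes u = (t; s) to s >= 0 with s_i + s_j + s_k <= t for distinct i, j, k;
   as t^2 = sum s_i^2 with nine terms, u is then (1; 1, 0, ..., 0) or
   (3; 1, ..., 1).  So there are at most two orbits of planes, and the planes
   read off from I_{2,10} = I_{1,1} + I_{1,1} + I_{0,8} = I_{1,1} + U + E8(-1)
   are inequivalent because only the second contains a characteristic vector.

   A point [v] of the boundary component of V determines V (x) R, the span of
   Re v and Im v, hence V; so equal images in the Satake compactification come
   from planes or lines in one orbit. *)

Require Import Defs.
From mathcomp Require Import all_boot all_order all_algebra.
From mathcomp Require Import boolp classical_sets functions cardinality reals.
From mathcomp Require Import complex zify ring.

Set Implicit Arguments.
Unset Strict Implicit.
Unset Printing Implicit Defensive.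

Import Order.TTheory GRing.Theory Num.Theory.
Local Open Scope ring_scope.
Local Open Scope quotient_scope.
Local Open Scope classical_set_scope.
Local Open Scope card_scope.

(* all_algebra exports another constant of this name. *)
Local Notation isometry := Defs.isometry.

(** * Isometries, transvections and reflections *)

Section Forms.
Variable K : lattice.
Implicit Types (x y z : 'rV[int]_(lrank K)) (k : int).

Lemma lformDl x y z : <| x + y : K, z |> = <| x : K, z |> + <| y : K, z |>.
Proof. by rewrite /= !mulmxDl mxE. Qed.

Lemma lformDr x y z : <| z : K, x + y |> = <| z : K, x |> + <| z : K, y |>.
Proof. by rewrite !(lformC z) lformDl. Qed.

Lemma lformZl k x y : <| k *: x : K, y |> = k * <| x : K, y |>.
Proof. by rewrite /= -!scalemxAl mxE. Qed.

Lemma lformZr k x y : <| x : K, k *: y |> = k * <| x : K, y |>.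
Proof. by rewrite !(lformC x) lformZl. Qed.

Lemma lformNl x y : <| - x : K, y |> = - <| x : K, y |>.
Proof. by rewrite -scaleN1r lformZl mulN1r. Qed.

Lemma lformNr x y : <| x : K, - y |> = - <| x : K, y |>.
Proof. by rewrite -scaleN1r lformZr mulN1r. Qed.

Lemma lform0l x : <| 0 : K, x |> = 0.
Proof. by rewrite -(scale0r 0) lformZl mul0r. Qed.

Lemma lform0r x : <| x : K, 0 |> = 0.
Proof. by rewrite lformC lform0l. Qed.

Definition lformE := (lformDl, lformDr, lformZl, lformZr, lformNl, lformNr, lform0l, lform0r).

(** The Eichler transvection of an isotropic e and a vector m orthogonal to e. The argument q stands
    for half the norm of m, so that no division of integers occurs. *)
Definition transvection (e m : 'rV[int]_(lrank K)) (q : int) x : 'rV[int]_(lrank K) :=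
  x - <| m : K, x |> *: e + <| e : K, x |> *: m - (q * <| e : K, x |>) *: e.

Lemma transvection_isometry e m q :
  <| e : K, e |> = 0 -> <| e : K, m |> = 0 -> <| m : K, m |> = 2 * q ->
  isometry_group K (transvection e m q).
Proof.
move=> ee em mm; have me : <| m : K, e |> = 0 by rewrite lformC.
have tK n : <| e : K, n |> = 0 -> <| n : K, n |> = 2 * q -> <| n : K, e |> = 0 ->
    cancel (transvection e n q) (transvection e (- n) q).
  move=> en nn ne x; rewrite /transvection !lformE ee en nn ne; apply/rowP => i.
  by rewrite !mxE; ring.
split.
- by move=> x y; rewrite /transvection !lformE; apply/rowP => i; rewrite !mxE; ring.
- exists (transvection e (- m) q); first exact: tK.
  rewrite -{2}[m]opprK; apply: tK; rewrite !lformE ?em ?me ?mm ?oppr0 //; ring.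
- move=> x y; rewrite /transvection !lformE ee em me mm.
  rewrite !(lformC x e) !(lformC x m); ring.
Qed.

(** Here s stands for 2 / <r|r>: it is 2 or -2 for r of norm 1 or -1, and -1 for a root of norm
    -2. *)
Definition reflection (r : 'rV[int]_(lrank K)) (s : int) x : 'rV[int]_(lrank K) :=
  x - (s * <| r : K, x |>) *: r.

Lemma reflection_isometry r s :
  s * <| r : K, r |> = 2 -> isometry_group K (reflection r s).
Proof.
move=> rr.
have rK : involutive (reflection r s).
  move=> x; rewrite /reflection !lformE; apply/rowP => i; rewrite !mxE.
  rewrite mulrBr [s * (_ * _)]mulrCA [_ * (s * _)]mulrAC rr; ring.
split.
- by move=> x y; rewrite /reflection !lformE; apply/rowP => i; rewrite !mxE; ring.
- by exists (reflection r s).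
- move=> x y; rewrite /reflection !lformE (lformC x r).
  apply/eqP; rewrite -subr_eq0; apply/eqP.
  transitivity (s * <| r : K, x |> * <| r : K, y |> * (s * <| r : K, r |> - 2)); first ring.
  by rewrite rr subrr mulr0.
Qed.

End Forms.

Section Isometries.

Lemma isometry_id (A : zform) : @isometry A A id.
Proof. by split=> //; exists id. Qed.

Lemma isometry_comp (A B C : zform) (g : B -> C) (h : A -> B) :
  isometry g -> isometry h -> isometry (g \o h).
Proof.
move=> [gD gb gf] [hD hb hf]; split; last by move=> x y /=; rewrite gf hf.
- by move=> x y /=; rewrite hD gD.
- exact: bij_comp.
Qed.

Lemma isometry_inv (A B : zform) (g : A -> B) : isometry g ->
  exists h : B -> A, [/\ isometry h, cancel g h & cancel h g].
Proof.
move=> [gD [h gK hK] gf]; exists h; split=> //; split; last by move=> x y; rewrite -gf !hK.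
- by move=> x y; apply: (can_inj gK); rewrite gD !hK.
- by exists g.
Qed.

Lemma isometric_sym (A B : zform) : isometric A B -> isometric B A.
Proof. by move=> [g /isometry_inv[h [hi _ _]]]; exists h. Qed.

Lemma isometric_trans (A B C : zform) :
  isometric A B -> isometric B C -> isometric A C.
Proof. by move=> [g gi] [h hi]; exists (h \o g); apply: isometry_comp. Qed.

Lemma isometry0 (A B : zform) (g : A -> B) : isometry g -> g 0 = 0.
Proof. by case=> gD _ _; apply: (addrI (g 0)); rewrite -gD !addr0. Qed.

Lemma isometryN (A B : zform) (g : A -> B) : isometry g -> {morph g : x / - x}.
Proof.
by move=> gi x; apply: (addrI (g x)); case: (gi) => gD _ _; rewrite -gD !subrr (isometry0 gi).
Qed.

Lemma isometryB (A B : zform) (g : A -> B) : isometry g -> {morph g : x y / x - y}.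
Proof. by move=> gi x y; case: (gi) => gD _ _; rewrite gD (isometryN gi). Qed.

Lemma isometryMz (A B : zform) (g : A -> B) k : isometry g -> {morph g : x / x *~ k}.
Proof.
move=> gi x; case: (gi) => gD _ _.
have gM n : g (x *+ n) = g x *+ n.
  by elim: n => [|n IH]; rewrite ?mulr0n ?(isometry0 gi) // !mulrS gD IH.
by case: k => n; rewrite ?NegzE ?mulrNz ?(isometryN gi) -!pmulrn gM.
Qed.

Definition equivalent (K : lattice) (v w : K) : Prop :=
  exists2 g, isometry_group K g & g v = w.

Lemma equivalent_refl (K : lattice) (v : K) : equivalent v v.
Proof. by exists id => //; apply: isometry_id. Qed.

Lemma equivalent_sym (K : lattice) (v w : K) : equivalent v w -> equivalent w v.
Proof.
by move=> [g /isometry_inv[h [hi gK _]]] <-; exists h.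
Qed.

Lemma equivalent_trans (K : lattice) (u v w : K) :
  equivalent u v -> equivalent v w -> equivalent u w.
Proof.
by move=> [g gi <-] [h hi <-]; exists (h \o g) => //; apply: isometry_comp.
Qed.

Lemma vector_orbitP (K : lattice) (v w : K) :
  vector_orbit v = vector_orbit w <-> equivalent v w.
Proof.
split=> [vw|vw].
  have : vector_orbit w w by exists id => //; exact: isometry_id.
  by rewrite -vw => -[g gi gv]; exists g.
apply/seteqP; split=> x [g gi gx].
  have /(equivalent_trans (equivalent_sym vw))[h hi hx] : equivalent v x by exists g.
  by exists h.
have /(equivalent_trans vw)[h hi hx] : equivalent w x by exists g.
by exists h.
Qed.

End Isometries.

(** * Isotropic vectors in lattices with two hyperbolic planes *)

Lemma mul_eq1_norm (k l : int) : k * l = 1 -> `|k| = 1.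
Proof.
by move=> /(congr1 absz)/eqP; rewrite abszM muln_eq1 -abszE => /andP[/eqP-> _].
Qed.

Lemma int_odd (z : int) : ~~ (2 %| z)%Z -> exists k, z = 2 * k + 1.
Proof. by move=> z2; exists (z %/ 2)%Z; lia. Qed.

(** A subgroup of Z is generated by its least positive member, since remainders of members modulo it
    are members; without positive members it is zero. *)
Lemma int_subgroup_generator (P : int -> Prop) :
  P 0 -> (forall x y, P x -> P y -> P (x - y)) ->
  exists2 d, P d & forall x, P x -> (d %| x)%Z.
Proof.
move=> P0 PB.
have PN x : P x -> P (- x) by move=> Px; rewrite -sub0r; apply: PB.
have PD x y : P x -> P y -> P (x + y) by move=> Px Py; rewrite -[y]opprK; apply/PB/PN.
have PM x (k : int) : P x -> P (k * x).
  move=> Px; have PMn n : P (n%:Z * x).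
    by elim: n => [|n IH]; rewrite ?mul0r // intS mulrDl mul1r; apply: PD.
  by case: k => n; rewrite ?NegzE ?mulNr; [|apply: PN]; apply: PMn.
have [exP|nP] := pselect (exists n, (0 < n)%N && `[< P n%:Z >]); last first.
  exists 0 => // x Px; rewrite dvd0z; apply/negP => /negP x0; apply: nP.
  exists `|x|%N; rewrite absz_gt0 x0; apply/asboolP.
  by rewrite abszE; case: (ger0P x) => // _; apply: PN.
have [d /andP[d0 /asboolP Pd] dmin] := ex_minnP exP.
exists d%:Z => // x Px; apply/negP => /negP dx.
have Pr : P (x %% d%:Z)%Z by apply/PB/PM.
have r0 : 0 <= (x %% d%:Z)%Z by rewrite modz_ge0 //; lia.
have : (x %% d%:Z)%Z < d%:Z by apply: ltz_pmod; lia.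
have rn0 : (x %% d%:Z)%Z != 0 by apply: contra dx => /eqP/dvdz_mod0P.
have := dmin `|(x %% d%:Z)%Z|%N; rewrite absz_gt0 rn0 abszE ger0_norm //.
by move=> /(_ (introT (asboolP _) Pr)); lia.
Qed.

(** * Divisibility and dual vectors in unimodular lattices *)

Section Unimodular.
Variable K : lattice.
Hypothesis uK : unimodular K.

(** The quotients by d of the coordinates of z in the dual basis define a functional, which the
    inverse Gram matrix represents by a lattice vector m. For d = 0 this is nondegeneracy of the
    form. *)
Lemma unimodular_dvd (d : int) (z : 'rV[int]_(lrank K)) :
  (forall x : K, (d %| <| x, z : K |>)%Z) -> exists m, z = d *: m.
Proof.
move=> dz; pose r : 'rV[int]_(lrank K) := \row_i (<| z : K, delta_mx ord0 i : K |> %/ d)%Z.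
exists (r *m invmx (gram K)); rewrite scalemxAl; apply: (canRL (mulmxK uK)).
apply/rowP => i; rewrite !mxE mulrC divzK; last by rewrite lformC.
by rewrite /= trmx_delta -colE !mxE.
Qed.

(** The values <y|v> form a subgroup dZ of Z. Then d divides v, so d is 1 or -1 by primitivity, and
    multiplying y by d corrects the sign. *)
Lemma primitive_dual (v : K) : (forall (k : int) (w : K), v = w *~ k -> `|k| = 1) ->
  exists y : K, <| y, v |> = 1.
Proof.
move=> pv.
have [||d [y yv] dP] := @int_subgroup_generator (fun k => exists y : K, <| y, v |> = k).
- by exists 0; rewrite lform0l.
- by move=> _ _ [x <-] [y <-]; exists (x - y); rewrite lformB.
have [|m vm] := @unimodular_dvd d v; first by move=> x; apply: dP; exists x.
have d1 : `|d| = 1 by apply: (pv d m); rewrite vm -scaler_int intz.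
exists (d *: (y : 'rV_(lrank K))); rewrite lformZl yv.
by case: (ger0P d) d1 => _ => [->|]; lia.
Qed.

End Unimodular.

Definition characteristic (K : lattice) (v : K) : Prop :=
  forall x : K, (2 %| <| x, x |> - <| x, v |>)%Z.

Lemma characteristic_isometry (K L : lattice) (g : K -> L) (v : K) :
  isometry g -> characteristic (g v) <-> characteristic v.
Proof.
move=> gi; have [h [_ gK hK]] := isometry_inv gi; case: gi => _ _ gf.
split=> cv x; first by rewrite -!gf.
by rewrite -[x]hK !gf.
Qed.

Lemma primitive_isotropic_isometry (K L : lattice) (g : K -> L) (v : K) :
  isometry g -> primitive_isotropic_vector K v -> primitive_isotropic_vector L (g v).
Proof.
move=> gi [v0 vv pv]; have [h [hi gK hK]] := isometry_inv gi; case: (gi) => _ _ gf.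
split; first by apply: contra v0 => /eqP gv; rewrite -[v]gK gv (isometry0 hi).
  by rewrite gf.
by move=> k w gvw; apply: (pv k (h w)); rewrite -(isometryMz _ hi) -gvw gK.
Qed.

Section TwoHyperbolicPlanes.
Variable K : lattice.
Variables e f e' f' : 'rV[int]_(lrank K).
Hypotheses (ee : <| e : K, e |> = 0) (ff : <| f : K, f |> = 0) (ef : <| e : K, f |> = 1).
Hypotheses (ee' : <| e' : K, e' |> = 0) (ff' : <| f' : K, f' |> = 0)
  (ef' : <| e' : K, f' |> = 1).
Hypotheses (e_e' : <| e : K, e' |> = 0) (e_f' : <| e : K, f' |> = 0)
  (f_e' : <| f : K, e' |> = 0) (f_f' : <| f : K, f' |> = 0).

Let fe : <| f : K, e |> = 1. Proof. by rewrite lformC. Qed.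
Let fe' : <| f' : K, e' |> = 1. Proof. by rewrite lformC. Qed.
Let e'_e : <| e' : K, e |> = 0. Proof. by rewrite lformC. Qed.
Let e'_f : <| e' : K, f |> = 0. Proof. by rewrite lformC. Qed.
Let f'_e : <| f' : K, e |> = 0. Proof. by rewrite lformC. Qed.
Let f'_f : <| f' : K, f |> = 0. Proof. by rewrite lformC. Qed.
Let frameE := (ee, ff, ef, ee', ff', ef', e_e', e_f', f_e', f_f',
               fe, fe', e'_e, e'_f, f'_e, f'_f).

Lemma equivalent_transvection (a m v : 'rV[int]_(lrank K)) q :
  <| a : K, a |> = 0 -> <| a : K, m |> = 0 -> <| m : K, m |> = 2 * q ->
  equivalent (v : K) (transvection a m q v).
Proof. by move=> aa am mm; exists (transvection a m q) => //; apply: transvection_isometry. Qed.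

(* The transvections along the four isotropic vectors act on the coordinates
   of v in the two planes as elementary row and column operations on a 2 x 2
   matrix; a minimal nonzero value of <f|w> on the orbit divides the others. *)
Lemma equivalent_orthogonal_plane (v : K) :
  exists w : 'rV[int]_(lrank K),
    [/\ equivalent v (w : K), <| e' : K, w |> = 0 & <| f' : K, w |> = 0].
Proof.
pose P n := (0 < n)%N && `[< exists2 w : K, equivalent v w & `|<| f : K, w |>|%N = n >].
(* If <f|w> vanishes on the whole orbit, then v is already orthogonal to the second plane: the
   transvections of v by e along e' and along f' change <f|v> by <e'|v> and <f'|v>. *)
have [exP|nP] := pselect (exists n, P n); last first.
  have f0 (w : K) : equivalent v w -> <| f : K, w |> = 0.
    move=> vw; apply/eqP/negP => /negP fw; apply: nP; exists `|<| f : K, w |>|%N.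
    by rewrite /P absz_gt0 fw; apply/asboolP; exists w.
  have vv := equivalent_refl v.
  exists v; split=> //.
    have /(equivalent_trans vv)/f0 : equivalent v (transvection e' e 0 v).
      by apply: equivalent_transvection; rewrite ?frameE.
    by rewrite /transvection !lformE !frameE f0 //; lia.
  have /(equivalent_trans vv)/f0 : equivalent v (transvection f' e 0 v).
    by apply: equivalent_transvection; rewrite ?frameE.
  by rewrite /transvection !lformE !frameE f0 //; lia.
have [a /andP[a0 /asboolP[w vw fw]] amin] := ex_minnP exP.
have modr (b c : int) : b != 0 -> exists k, 0 <= c - k * b < `|b|.
  by move=> b0; exists (c %/ b)%Z; rewrite -/(modz c b) modz_ge0 //= ltz_mod.
have small (u : K) (c : int) : equivalent v u -> `|<| f : K, u |>|%N = a -> 0 <= c < a%:Z ->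
    (forall k, exists2 u' : K, equivalent u u' & <| f : K, u' |> = <| f : K, u |> + k * c) ->
    c = 0.
  move=> vu fu /andP[c0 ca] uP; apply/eqP/negP => /negP cn0.
  have c_gt0 : 0 < c by rewrite lt_def cn0.
  (* Reducing <f|u> - 1 instead of <f|u> modulo c makes the new value lie between 1 and c, hence
     positive and below the minimum a. *)
  have [u' /(equivalent_trans vu) vu' fu'] := uP (- ((<| f : K, u |> - 1) %/ c)%Z).
  have r1 := modz_ge0 (<| f : K, u |> - 1) cn0.
  have r2 := ltz_pmod (<| f : K, u |> - 1) c_gt0.
  have r3 := divz_eq (<| f : K, u |> - 1) c.
  have : P `|<| f : K, u' |>|%N.
    by apply/andP; split; [rewrite fu'; lia | apply/asboolP; exists u'].
  by move=> /amin; rewrite fu'; lia.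
have fw0 : <| f : K, w |> != 0 by rewrite -absz_gt0 fw.
(* The transvection along f' by k f keeps <f|w> and subtracts k <f|w> from <e'|w>, leaving a
   remainder below the minimum, which [small] shows to be 0. The value on f' is then cleared in the
   same way by a transvection along e'. *)
have [k kP] := modr _ <| e' : K, w |> fw0.
pose w1 := transvection f' (k *: f) 0 w.
have w01 : equivalent w w1 by apply: equivalent_transvection; rewrite ?lformE ?frameE ?mulr0.
have fw1 : <| f : K, w1 |> = <| f : K, w |>.
  by rewrite /w1 /transvection !lformE !frameE; lia.
have ew1 : <| e' : K, w1 |> = 0.
  have ew1 : <| e' : K, w1 |> = <| e' : K, w |> - k * <| f : K, w |>.
    by rewrite /w1 /transvection !lformE !frameE; lia.
  apply: (small w1 <| e' : K, w1 |>); [exact: equivalent_trans w01 | by rewrite fw1 | by rewrite ew1; lia|].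
  move=> l; exists (transvection e' (l *: e) 0 w1).
    by apply: equivalent_transvection; rewrite ?lformE ?frameE ?mulr0.
  by rewrite /transvection !lformE !frameE; lia.
clearbody w1.
have [l lP] := modr _ <| f' : K, w1 |> fw0.
pose w2 := transvection e' (l *: f) 0 w1.
have w12 : equivalent w1 w2 by apply: equivalent_transvection; rewrite ?lformE ?frameE ?mulr0.
have vw2 : equivalent v w2 by apply/(equivalent_trans vw)/(equivalent_trans w01).
have fw2 : <| f : K, w2 |> = <| f : K, w |>.
  by rewrite /w2 /transvection !lformE !frameE; lia.
exists w2; split=> //; first by rewrite /w2 /transvection !lformE !frameE ew1; lia.
have f'w2 : <| f' : K, w2 |> = <| f' : K, w1 |> - l * <| f : K, w |>.
  by rewrite /w2 /transvection !lformE !frameE fw1; lia.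
apply: (small w2 <| f' : K, w2 |>) => //; [by rewrite fw2 | by rewrite f'w2; lia|].
move=> k'; exists (transvection f' (k' *: e) 0 w2).
  by apply: equivalent_transvection; rewrite ?lformE ?frameE ?mulr0.
by rewrite /transvection !lformE !frameE; lia.
Qed.

(** The part of x removed lies in the span of e' and f', which is an even lattice, so the parity of
    the norm survives. *)
Lemma ortho_plane_projection (w x : 'rV[int]_(lrank K)) :
  <| e' : K, w |> = 0 -> <| f' : K, w |> = 0 ->
  exists y : 'rV[int]_(lrank K), [/\ <| e' : K, y |> = 0, <| f' : K, y |> = 0,
    <| y : K, w |> = <| x : K, w |> & (2 %| <| y : K, y |> - <| x : K, x |>)%Z].
Proof.
move=> ew fw; exists (x - <| f' : K, x |> *: e' - <| e' : K, x |> *: f').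
rewrite !lformE !frameE ew fw !(lformC x f') !(lformC x e'); split; lia.
Qed.

Hypothesis uK : unimodular K.

(** Once v is moved to w orthogonal to the second plane, an m of even norm with <m|w> = 1 gives w ->
    w + e' by a transvection along e', and then w + e' -> e' by the transvection by -w along f'.
    That v is not characteristic allows the norm of m to be made even. *)
Lemma equivalent_noncharacteristic (v : K) :
  primitive_isotropic_vector K v -> ~ characteristic v -> equivalent v (e' : K).
Proof.
move=> [_ vv /(primitive_dual uK)[y yv]] /existsNP[x /negP xv].
have [w [vw ew fw]] := equivalent_orthogonal_plane v.
case: (vw) => g gi gv; case: (gi) => gD _ gf.
have ww : <| w : K, w |> = 0 by rewrite -gv gf.
have [y1 [ey fy yw _]] := ortho_plane_projection (g y) ew fw.
rewrite -gv gf yv gv in yw.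
have [x1 [ex fx xw xx]] := ortho_plane_projection (g x) ew fw.
rewrite -gv !gf gv in xw xx.
have we : <| w : K, e' |> = 0 by rewrite lformC.
have wf : <| w : K, f' |> = 0 by rewrite lformC.
suff [m [em fm mw [q mm]]] : exists m : 'rV[int]_(lrank K),
    [/\ <| e' : K, m |> = 0, <| f' : K, m |> = 0, <| m : K, w |> = 1
      & exists q, <| m : K, m |> = 2 * q].
  apply: (equivalent_trans vw).
  have t1 : transvection e' (- m) q w = w + e'.
    by rewrite /transvection !lformE ew mw; apply/rowP => i; rewrite !mxE; ring.
  have /equivalent_trans : equivalent (w : K) (w + e').
    by rewrite -t1; apply: equivalent_transvection; rewrite ?lformE ?em ?mm //; lia.
  apply; have t2 : transvection f' (- w) 0 (w + e') = e'.
    by rewrite /transvection !lformE ww we fw fe'; apply/rowP => i; rewrite !mxE; ring.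
  by rewrite -{2}t2; apply: equivalent_transvection; rewrite ?lformE ?fw ?ww //; lia.
have [/dvdzP[q y2]|/int_odd[r y2]] := boolP (2 %| <| y1 : K, y1 |>)%Z.
  by exists y1; split=> //; exists q; lia.
have [k xwk] : exists k, <| x1 : K, x1 |> - <| x1 : K, w |> = 2 * k + 1.
  apply: int_odd; apply: contra xv => h.
  rewrite -xw -[X in (_ %| X)%Z](_ : <| x1 : K, x1 |> - <| x1 : K, w |>
    - (<| x1 : K, x1 |> - <| x, x |>) = _); last ring.
  by rewrite rpredB.
have [/dvdzP[q x2]|/int_odd[q x2]] := boolP (2 %| <| x1 : K, x1 |>)%Z.
  pose j := <| x1 : K, w |> - 1.
  exists (x1 - j *: y1); rewrite !lformE ex ey fx fy yw !(lformC y1 x1); split; try lia.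
  have -> : j = 2 * (q - k - 1) by rewrite /j; lia.
  exists (q - 2 * (q - k - 1) * <| x1 : K, y1 |> + 2 * (q - k - 1) ^+ 2 * <| y1 : K, y1 |>).
  by rewrite x2; ring.
pose j := <| x1 : K, w |> - 1.
exists (x1 - j *: y1); rewrite !lformE ex ey fx fy yw !(lformC y1 x1); split; try lia.
have -> : j = 2 * (q - k - 1) + 1 by rewrite /j; lia.
exists (q - (2 * (q - k - 1) + 1) * <| x1 : K, y1 |> + (r + 1)
  + (2 * (q - k - 1) ^+ 2 + 2 * (q - k - 1)) * <| y1 : K, y1 |>).
by rewrite x2 y2; ring.
Qed.

(** A characteristic w has even products with vectors of even norm, so the first transvection uses 2
    m and yields w + 2 e'. Two characteristic vectors differ by twice a lattice vector m', and a
    transvection along f' by m' turns w into s. The vector n serves to correct the parity of the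
    norm of m'. *)
Lemma equivalent_characteristic (s n : 'rV[int]_(lrank K)) (v : K) :
  characteristic (s : K) -> <| s : K, s |> = - 8 ->
  <| e' : K, s |> = 0 -> <| f' : K, s |> = 0 ->
  <| n : K, n |> = -1 -> <| n : K, s |> = -1 ->
  <| e' : K, n |> = 0 -> <| f' : K, n |> = 0 ->
  primitive_isotropic_vector K v -> characteristic v ->
  equivalent v (2 *: e' + 2 *: f' + s : K).
Proof.
move=> cs ss es fs nn ns en fn [_ vv /(primitive_dual uK)[y yv]] cv.
have [w [vw ew fw]] := equivalent_orthogonal_plane v.
case: (vw) => g gi gv; case: (gi) => gD _ gf.
have ww : <| w : K, w |> = 0 by rewrite -gv gf.
have cw : characteristic (w : K) by rewrite -gv; apply/(characteristic_isometry v gi).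
have [m [em fm mw _]] := ortho_plane_projection (g y) ew fw.
rewrite -gv gf yv gv in mw.
have we : <| w : K, e' |> = 0 by rewrite lformC.
have wf : <| w : K, f' |> = 0 by rewrite lformC.
apply: (equivalent_trans vw).
have t1 : transvection e' (- (2 *: m)) (2 * <| m : K, m |>) w = w + 2 *: e'.
  by rewrite /transvection !lformE ew mw; apply/rowP => i; rewrite !mxE; ring.
have /equivalent_trans : equivalent (w : K) (w + 2 *: e').
  by rewrite -t1; apply: equivalent_transvection; rewrite ?lformE ?em //; lia.
apply.
have key (s' : 'rV[int]_(lrank K)) (m' : 'rV[int]_(lrank K)) q :
    <| s' : K, s' |> = - 8 -> <| f' : K, s' |> = 0 -> <| e' : K, s' |> = 0 ->
    s' - w = 2 *: m' -> <| m' : K, m' |> = 2 * q ->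
    equivalent (w + 2 *: e' : K) (2 *: e' + 2 *: f' + s').
  move=> ss' fs' es' sw mm.
  have fm' : <| f' : K, m' |> = 0.
    by apply: (mulfI (isT : 2 != 0 :> int)); rewrite -lformZr -sw !lformE fs' fw; lia.
  have em' : <| m' : K, e' |> = 0.
    apply: (mulfI (isT : 2 != 0 :> int)); rewrite -lformZl -sw !lformE lformC es' we; lia.
  have h1 : 2 * <| m' : K, w |> = <| s' : K, w |>.
    by rewrite -lformZl -sw !lformE ww; lia.
  have h2 : 8 * q = - 8 - 2 * <| s' : K, w |>.
    have -> : 8 * q = <| 2 *: m' : K, 2 *: m' |> by rewrite !lformE mm; ring.
    by rewrite -sw !lformE ww ss' !(lformC w s'); lia.
  have t2 : transvection f' m' q (w + 2 *: e') = 2 *: e' + 2 *: f' + s'.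
    (* Since w + 2 m' has norm -8, <m'|w> = -2 - 2 q; this makes the coefficient of f' in the image
       equal to 2. *)
    have mw' : <| m' : K, w |> = - 2 - 2 * q by lia.
    rewrite /transvection !lformE fw fe' em' mw'.
    by rewrite -[s'](subrK w) sw; apply/rowP => i; rewrite !mxE; ring.
  by rewrite -t2; apply: equivalent_transvection.
have [|m' sw] := @unimodular_dvd K uK 2 (s - w).
  move=> x; rewrite lformDr lformNr.
  rewrite (_ : _ - _ = (<| x, x |> - <| x, w : K |>) - (<| x, x |> - <| x, s : K |>)); last ring.
  by rewrite rpredB.
have [/dvdzP[q mm]|m2] := boolP (2 %| <| m' : K, m' |>)%Z.
  by apply: (key s m' q) => //; rewrite mm mulrC.
have [q mm] := int_odd m2.
(* The vector s - 2 n is the image of s under the reflection in n. Aiming at it replaces m' by m' -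
   n, whose norm is even, and the reflection then carries it back to s while fixing e' and f'. *)
have /equivalent_trans : equivalent (w + 2 *: e' : K) (2 *: e' + 2 *: f' + (s - 2 *: n)).
  apply: (key _ (m' - n) (q - <| m' : K, n |>)).
  - by rewrite !lformE ss nn ns (lformC s n) ns; lia.
  - by rewrite !lformE fs fn; lia.
  - by rewrite !lformE es en; lia.
  - by rewrite scalerBr -sw; apply/rowP => i; rewrite !mxE; ring.
  - by rewrite !lformE mm nn (lformC n m'); lia.
apply; exists (reflection n (-2)); first by apply: reflection_isometry; rewrite nn.
rewrite /reflection !lformE !(lformC n e') !(lformC n f') en fn ns nn.
by apply/rowP => i; rewrite !mxE; ring.
Qed.

End TwoHyperbolicPlanes.

(** * Explicit isometries of I_{2,10} *)

(** Entries given by functions on natural numbers can be multiplied by computation, independently of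
    ordinals. *)
Definition gram_coef (L : lattice) (c : nat -> nat -> int) : Prop :=
  gram L = \matrix_(i, j) c i j.

Definition Ipm_coef (p i j : nat) : int :=
  (if (i < p)%N then 1 else -1) *+ (i == j).

Lemma Ipm_gram_coef (p m : nat) : gram_coef (Ipm p m) (Ipm_coef p).
Proof.
rewrite /gram_coef /=; apply/matrixP => i j; rewrite !mxE /Ipm_coef; congr (_ *+ _).
by case: splitP => k _; rewrite mxE.
Qed.

Lemma lattice_neg_gram_coef (L : lattice) c :
  gram_coef L c -> gram_coef (lattice_neg L) (fun i j => - c i j).
Proof. by rewrite /gram_coef /= => ->; apply/matrixP => i j; rewrite !mxE. Qed.

Definition block_coef (r : nat) (a b : nat -> nat -> int) (i j : nat) : int :=
  if (i < r)%N then if (j < r)%N then a i j else 0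
  else if (j < r)%N then 0 else b (i - r)%N (j - r)%N.

Lemma lattice_sum_gram_coef (A B : lattice) a b :
  gram_coef A a -> gram_coef B b ->
  gram_coef (lattice_sum A B) (block_coef (lrank A) a b).
Proof.
rewrite /gram_coef /= => -> ->; apply/matrixP => i j; rewrite !mxE /block_coef.
case: (splitP i) => k ei; rewrite !mxE; case: (splitP j) => l ej; rewrite !mxE ?ei ?ej //.
by rewrite !addKn.
Qed.

Lemma Ipm_unimodular (p m : nat) : unimodular (Ipm p m).
Proof.
suff: gram (Ipm p m) *m gram (Ipm p m) = 1%:M by case/mulmx1_unit.
rewrite Ipm_gram_coef; apply/matrixP => i j.
rewrite mxE (bigD1 i) //= big1 => [|k ki].
  by rewrite !mxE /Ipm_coef eqxx addr0 val_eqE; case: ifP; case: eqP.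
by rewrite !mxE /Ipm_coef val_eqE eq_sym (negPf ki) mul0r.
Qed.

(** The rows of P are vectors of B with Gram matrix A. As A is invertible, B P^T A^-1 is an inverse
    of P, so only the product P B P^T has to be computed. *)
Lemma isometric_gram_coef (A B : lattice) (a b p : nat -> nat -> int) (n : nat) :
  gram_coef A a -> gram_coef B b -> unimodular A -> lrank A = n -> lrank B = n ->
  all (fun i => all (fun j =>
    mul_coef n (mul_coef n p b) (fun k l => p l k) i j == a i j) (iota 0 n)) (iota 0 n) ->
  isometric A B.
Proof.
case: A B => r A sA [s B sB]; rewrite /gram_coef /unimodular /= => Aa Bb uA rn sn.
case: _ / (esym rn) in A sA Aa uA *; case: _ / (esym sn) in B sB Bb *.
move=> /eq_mx_coef; rewrite -Aa -(mulmx_coef _ (mul_coef n p b)) -mulmx_coef -Bb.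
set P := \matrix_(i, j) p i j; set Pt := \matrix_(i, j) _.
have -> : Pt = P^T by apply/matrixP => i j; rewrite !mxE.
move=> PBP.
have PQ : P *m (B *m P^T *m invmx A) = 1%:M by rewrite !mulmxA PBP mulmxV.
exists (fun x : 'rV_n => x *m P); split.
- by move=> x y; apply: mulmxDl.
- exists (mulmxr (B *m P^T *m invmx A)) => x /=; rewrite -mulmxA.
    by rewrite PQ mulmx1.
  by rewrite (mulmx1C PQ) mulmx1.
- by move=> x y /=; rewrite trmx_mul -PBP !mulmxA.
Qed.

Lemma Ipm_2_10_odd_splitting :
  isometric (lattice_sum (Ipm 1 1) (Ipm 1 9)) (Ipm 2 10).
Proof.
(* The basis of the sum has norms 1, -1, 1, -1, ..., -1; exchanging positions 1 and 2 puts the two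
   positive vectors first. *)
pose s := [:: 0; 2; 1; 3; 4; 5; 6; 7; 8; 9; 10; 11]%N.
apply: (isometric_gram_coef (p := fun i j => (nth 0%N s i == j)%:R) (n := 12)) => //.
- by apply: lattice_sum_gram_coef; apply: Ipm_gram_coef.
- exact: Ipm_gram_coef.
- by apply: dsum_unimodular; apply: Ipm_unimodular.
- by vm_compute.
Qed.

Lemma Ipm_2_10_odd_splitting2 :
  isometric (lattice_sum (Ipm 1 1) (lattice_sum (Ipm 1 1) (Ipm 0 8))) (Ipm 2 10).
Proof.
pose s := [:: 0; 2; 1; 3; 4; 5; 6; 7; 8; 9; 10; 11]%N.
apply: (isometric_gram_coef (p := fun i j => (nth 0%N s i == j)%:R) (n := 12)) => //.
- by do 2?[apply: lattice_sum_gram_coef]; apply: Ipm_gram_coef.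
- exact: Ipm_gram_coef.
- by do 2?[apply: dsum_unimodular]; apply: Ipm_unimodular.
- by vm_compute.
Qed.

(* Write a0, a1 for the basis vectors of norm 1 and b0, ..., b9 for those of
   norm -1.  The vector k = 3 a1 + b0 + ... + b7 has norm 1 and its orthogonal
   complement in the span of a1, b0, ..., b7 is E8(-1); moreover a0, b8, b9 span
   U + <n>, with n = a0 + b8 + b9.  The rows below are k, n, the isotropic
   vectors a0 + b8 and a0 + b9, and the simple roots of E8(-1). *)
Definition Ipm_2_10_even_basis : seq (seq int) :=
  [:: [:: 0; 3; 1; 1; 1; 1; 1; 1; 1; 1; 0; 0];
      [:: 1; 0; 0; 0; 0; 0; 0; 0; 0; 0; 1; 1];
      [:: 1; 0; 0; 0; 0; 0; 0; 0; 0; 0; 1; 0];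
      [:: 1; 0; 0; 0; 0; 0; 0; 0; 0; 0; 0; 1];
      [:: 0; 0; -1; 1; 0; 0; 0; 0; 0; 0; 0; 0];
      [:: 0; 1; 1; 1; 1; 0; 0; 0; 0; 0; 0; 0];
      [:: 0; 0; 0; -1; 1; 0; 0; 0; 0; 0; 0; 0];
      [:: 0; 0; 0; 0; -1; 1; 0; 0; 0; 0; 0; 0];
      [:: 0; 0; 0; 0; 0; -1; 1; 0; 0; 0; 0; 0];
      [:: 0; 0; 0; 0; 0; 0; -1; 1; 0; 0; 0; 0];
      [:: 0; 0; 0; 0; 0; 0; 0; -1; 1; 0; 0; 0];
      [:: 0; 0; 0; 0; 0; 0; 0; 0; -1; 1; 0; 0]].

Lemma Ipm_2_10_even_splitting :
  isometric (lattice_sum (Ipm 1 1) II_1_9) (Ipm 2 10).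
Proof.
apply: (isometric_gram_coef (p := coef_of Ipm_2_10_even_basis) (n := 12)) => //.
- apply: lattice_sum_gram_coef; first exact: Ipm_gram_coef.
  apply: lattice_sum_gram_coef; last exact: lattice_neg_gram_coef.
  by instantiate (1 := fun i j => (i != j)%:R).
- exact: Ipm_gram_coef.
- by apply: dsum_unimodular; [apply: Ipm_unimodular | case: II_1_9_spec].
- by vm_compute.
Qed.

(** * Coordinates and characteristic vectors in I_{p,m} *)

Definition seq_row (n : nat) (s : seq int) : 'rV[int]_n := \row_i s`_i.

Lemma Ipm_formE (p m : nat) (x y : Ipm p m) :
  <| x, y |> = \sum_(i < p) x ord0 (lshift m i) * y ord0 (lshift m i)
             - \sum_(j < m) x ord0 (rshift p j) * y ord0 (rshift p j).
Proof.
rewrite /= mul_mx_diag mxE big_split_ord -sumrN /=; congr (_ + _).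
  by apply: eq_bigr => i _; rewrite mxE row_mxEl !mxE mulr1.
by apply: eq_bigr => i _; rewrite mxE row_mxEr !mxE mulrN1 mulNr.
Qed.

Lemma Ipm_seq_row (p m : nat) (s t : seq int) :
  <| seq_row (p + m) s : Ipm p m, seq_row (p + m) t : Ipm p m |> =
  foldr (fun k r => Ipm_coef p k k * (s`_k * t`_k) + r) 0 (iota 0 (p + m)).
Proof.
rewrite /= mul_mx_diag mxE; pose F k := Ipm_coef p k k * (s`_k * t`_k).
transitivity (\sum_(i < p + m) F i).
  apply: eq_bigr => i _; rewrite !mxE /F /Ipm_coef eqxx mulr1n mulrA [_ * s`_i]mulrC.
  by case: splitP => k _; rewrite mxE.
rewrite -(big_mkord xpredT F) /index_iota subn0.
by elim: (iota 0 _) => [|k r IH]; rewrite ?big_nil ?big_cons //= IH.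
Qed.

Lemma dvd2_sqrB (x : int) : (2 %| x * x - x)%Z.
Proof.
have [/dvdzP[k ->]|/int_odd[k ->]] := boolP (2 %| x)%Z.
  by apply/dvdzP; exists (k * (2 * k - 1)); ring.
by apply/dvdzP; exists ((2 * k + 1) * k); ring.
Qed.

(** Coordinate by coordinate this is the congruence of x^2 and x modulo 2. *)
Lemma characteristic_Ipm (p m : nat) : characteristic (const_mx 1 : Ipm p m).
Proof.
move=> x; rewrite !Ipm_formE.
rewrite [X in (_ %| X)%Z](_ : forall a b c d : int, a - b - (c - d) = a - c - (b - d)).
  by rewrite -!sumrB rpredB ?rpred_sum // => i _; rewrite mxE mulr1 dvd2_sqrB.
by move=> a b c d; ring.
Qed.

(** * Vinberg reduction in I_{1,9} *)

Section LorentzDescent.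

Definition lorentz_vec (t : int) (s : 'rV[int]_9) : 'rV[int]_(1 + 9) :=
  row_mx t%:M s.

Lemma lorentz_form t s t' s' :
  <| lorentz_vec t s : Ipm 1 9, lorentz_vec t' s' |> =
  t * t' - \sum_j s ord0 j * s' ord0 j.
Proof.
rewrite Ipm_formE big_ord1 !row_mxEl !mxE !eqxx; congr (_ - _).
by apply: eq_bigr => j _; rewrite !row_mxEr.
Qed.

Lemma lorentz_vecP (x : 'rV[int]_(1 + 9)) : exists t s, x = lorentz_vec t s.
Proof.
exists (lsubmx x 0 0), (rsubmx x); rewrite -[LHS]hsubmxK; congr row_mx.
by rewrite [LHS]mx11_scalar.
Qed.

Lemma lorentz_vecD t s t' s' :
  lorentz_vec t s + lorentz_vec t' s' = lorentz_vec (t + t') (s + s').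
Proof. by rewrite /lorentz_vec add_row_mx raddfD. Qed.

Lemma lorentz_vecZ k t s : k *: lorentz_vec t s = lorentz_vec (k * t) (k *: s).
Proof. by rewrite /lorentz_vec scale_row_mx scale_scalar_mx. Qed.

Lemma equivalent_abs t (s : 'rV[int]_9) :
  equivalent (lorentz_vec t s : Ipm 1 9) (lorentz_vec t (\row_j `|s ord0 j|)).
Proof.
pose e j : int := if s ord0 j < 0 then -1 else 1.
have ee j : e j * e j = 1 by rewrite /e; case: ifP.
pose g (x : 'rV[int]_(1 + 9)) := row_mx (lsubmx x) (\row_j (e j * rsubmx x ord0 j)).
have gv u z : g (lorentz_vec u z) = lorentz_vec u (\row_j (e j * z ord0 j)).
  by rewrite /g row_mxKl row_mxKr.
have gg : involutive g.
  move=> x; have [u [z ->]] := lorentz_vecP x; rewrite !gv; congr lorentz_vec.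
  by apply/rowP => j; rewrite !mxE mulrA ee mul1r.
exists g; last first.
  rewrite gv; congr lorentz_vec; apply/rowP => j; rewrite !mxE /e.
  by case: ltrgt0P => [||->]; rewrite ?mulN1r ?mul1r ?mulr0.
split; last 1 first.
- move=> x y; have [u [z ->]] := lorentz_vecP x; have [u' [z' ->]] := lorentz_vecP y.
  rewrite !gv !lorentz_form; congr (_ - _); apply: eq_bigr => j _.
  by rewrite !mxE mulrACA ee mul1r.
- move=> x y; have [u [z ->]] := lorentz_vecP x; have [u' [z' ->]] := lorentz_vecP y.
  rewrite [_ + lorentz_vec _ _](lorentz_vecD u z) !gv [RHS]lorentz_vecD.
  by congr lorentz_vec; apply/rowP => j; rewrite !mxE mulrDr.
- by exists g.
Qed.

Lemma equivalent_opp (K : lattice) (v : K) : equivalent v (- v).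
Proof.
exists -%R => //; split; first by move=> x y; rewrite opprD.
  by exists -%R; apply: opprK.
by move=> x y; rewrite lformNl lformNr opprK.
Qed.

Lemma sum_sub3 (F : 'I_9 -> int) i j k : i != j -> i != k -> j != k ->
  \sum_l F l = F i + F j + F k + \sum_(l | [&& l != i, l != j & l != k]) F l.
Proof.
move=> ij ik jk; rewrite (bigD1 i) //= (bigD1 j) 1?eq_sym //= (bigD1 k) /=; last first.
  by rewrite ![k == _]eq_sym ik.
by rewrite !addrA; congr (_ + _); apply: eq_bigl => l; rewrite andbA.
Qed.

(** The triple inequalities say that the vector has nonnegative product with each root (1; d), d
    having entries 1 at i, j, k and 0 elsewhere. No order is imposed on the coordinates of s. *)
Definition reduced (t : int) (s : 'rV[int]_9) : Prop :=
  (forall j, 0 <= s ord0 j) /\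
  forall i j k, i != j -> i != k -> j != k -> s ord0 i + s ord0 j + s ord0 k <= t.

Lemma reflection_triple t (s : 'rV[int]_9) i j k : i != j -> i != k -> j != k ->
  exists s', equivalent (lorentz_vec t s : Ipm 1 9)
    (lorentz_vec (2 * t - (s ord0 i + s ord0 j + s ord0 k)) s').
Proof.
move=> ij ik jk.
pose d : 'rV[int]_9 := \row_l ((l == i) || (l == j) || (l == k))%:R.
have dE (z : 'rV[int]_9) : \sum_l d ord0 l * z ord0 l = z ord0 i + z ord0 j + z ord0 k.
  rewrite (sum_sub3 _ ij ik jk) !mxE !eqxx !orbT !mul1r big1 ?addr0 // => l.
  by rewrite mxE => /and3P[/negPf-> /negPf-> /negPf->]; rewrite mul0r.
pose r := lorentz_vec 1 d.
have rr : <| r : Ipm 1 9, r |> = - 2.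
  by rewrite lorentz_form dE !mxE !eqxx !orbT.
have : equivalent (lorentz_vec t s : Ipm 1 9) (@reflection (Ipm 1 9) r (-1) (lorentz_vec t s)).
  by exists (@reflection (Ipm 1 9) r (-1)) => //; apply: reflection_isometry; rewrite rr.
rewrite /reflection lorentz_form dE -scaleNr lorentz_vecZ lorentz_vecD.
set c := s ord0 i + _ + _; rewrite mulN1r opprK mul1r mulr1.
by rewrite (_ : t + (t - c) = 2 * t - c); [eexists; eassumption | ring].
Qed.

Lemma equivalent_reduced (x : 'rV[int]_(1 + 9)) : <| x : Ipm 1 9, x |> = 0 ->
  exists t s, equivalent (x : Ipm 1 9) (lorentz_vec t s) /\ reduced t s.
Proof.
have [t [s ->]] := lorentz_vecP x.
have [n] := ubnP `|t|%N; elim: n t s {x} => // n IH t s; rewrite ltnS => tn ts0.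
have [t1 [s1 [vv t1E s1_ge0]]] : exists t1 s1,
    [/\ equivalent (lorentz_vec t s : Ipm 1 9) (lorentz_vec t1 s1), t1 = `|t|
      & forall j, 0 <= s1 ord0 j].
  have [u [z [vv uE]]] : exists u z,
      equivalent (lorentz_vec t s : Ipm 1 9) (lorentz_vec u z) /\ u = `|t|.
    case: (ger0P t) => _; first by exists t, s; split=> //; apply: equivalent_refl.
    exists (- t), (- s); split=> //; have := equivalent_opp (lorentz_vec t s : Ipm 1 9).
    by rewrite -scaleN1r lorentz_vecZ mulN1r scaleN1r.
  exists u, (\row_j `|z ord0 j|); split=> [|//|j]; last by rewrite mxE.
  exact/(equivalent_trans vv)/equivalent_abs.
have [g [_ _ gf] gv] := vv.
have ts1 : <| lorentz_vec t1 s1 : Ipm 1 9, lorentz_vec t1 s1 |> = 0 by rewrite -gv gf.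
have [red|] := pselect (reduced t1 s1); first by exists t1, s1.
move=> /not_andP[//|/existsNP[i /existsNP[j /existsNP[k]]]].
move=> /not_implyP[ij /not_implyP[ik /not_implyP[jk /negP]]]; rewrite -ltNge => tlt.
have [s2 v2] := reflection_triple t1 s1 ij ik jk.
have [h [_ _ hf] hv] := v2.
have : <| lorentz_vec t1 s1 : Ipm 1 9, lorentz_vec t1 s1 |> = 0 by [].
rewrite lorentz_form (sum_sub3 _ ij ik jk) /=.
set S := \sum_(l | _) _ => tS.
have S0 : 0 <= S by apply: sumr_ge0 => l _; rewrite -expr2 sqr_ge0.
set t2 := 2 * t1 - _ in v2 hv.
have [||u [z [eq_uz red]]] := IH t2 s2.
- have := s1_ge0 i; have := s1_ge0 j; have := s1_ge0 k; move: tlt tS; rewrite /t2.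
  move: (s1 ord0 i) (s1 ord0 j) (s1 ord0 k) => a b c tlt tS c0 b0 a0.
  have t10 : 0 <= t1 by rewrite t1E.
  (* From t1 < a + b + c < 3 t1 the new coordinate 2 t1 - (a + b + c) is less than t1 in absolute
     value. If the upper bound failed, then 9 t1^2 <= (a + b + c)^2 <= 3 (a^2 + b^2 + c^2) <= 3
     t1^2, and a, b, c would vanish. *)
  suff : a + b + c < 3 * t1 by lia.
  rewrite ltNge; apply/negP => le3.
  have sq0 (z : int) : 0 <= z * z by rewrite -expr2 sqr_ge0.
  have t9 : (3 * t1) * (3 * t1) <= (a + b + c) * (a + b + c) by apply: ler_pM; lia.
  have := sq0 (a - b); have := sq0 (a - c); have := sq0 (b - c).
  have := sq0 a; have := sq0 b; have := sq0 c; have := sq0 t1 => ? ? ? ? ? ? ?.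
  have /eqP : a * a + b * b + c * c = 0 by lia.
  rewrite -!expr2 !paddr_eq0 ?addr_ge0 ?sqr_ge0 // !sqrf_eq0.
  by move=> /andP[/andP[/eqP a00 /eqP b00] /eqP c00]; lia.
- by rewrite -hv hf.
- exists u, z; split=> //; apply: (equivalent_trans vv); exact: (equivalent_trans v2).
Qed.

(** Expanding (a + b + c)^2 <= t^2 gives 2 (a b + a c + b c) <= 6 c^2 - S, while each of the three
    products is at least c^2. So all of these are equalities, which forces a = b = c unless c = 0;
    in that case a b = 0 gives b = 0. *)
Lemma norm_bound_equality (a b c t S : int) :
  0 <= c -> c <= b -> b <= a -> 0 <= S ->
  t * t = a * a + b * b + 7 * (c * c) - S -> a + b + c <= t ->
  [/\ c = 0, b = 0 & t = a] \/ [/\ a = c, b = c, t = 3 * c & S = 0].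
Proof.
move=> c0 cb ba S0 tt le3.
have b0 : 0 <= b by lia.
have a0 : 0 <= a by lia.
have le_tt : (a + b + c) * (a + b + c) <= t * t by apply: ler_pM => //; rewrite !addr_ge0.
have bb : b * b <= a * b by apply: ler_pM.
have cc : c * c <= b * c by apply: ler_pM.
have bc_ac : b * c <= a * c by apply: ler_pM.
have cc_ab : c * c <= a * b by apply: ler_pM => //; apply: le_trans ba.
have [cE|cn0] := eqVneq c 0.
  left; have b2 := mulr_ge0 b0 b0; rewrite {}cE in tt le_tt le3 *.
  have /eqP : b * b = 0 by lia.
  rewrite mulf_eq0 orbb => /eqP bE; split=> //; rewrite {}bE in tt le_tt le3 *.
  have a2 : t * t <= a * a by lia.
  apply/eqP; rewrite eq_le -(ler_pXn2r (isT : (0 < 2)%N)) ?nnegrE //; last by lia.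
  by rewrite !expr2 a2; lia.
right; have /(mulIf cn0) aE : a * c = c * c by lia.
have /(mulIf cn0) bE : b * c = c * c by lia.
rewrite {}aE {}bE in tt le_tt le3 *.
have /eqP : t * t = (3 * c) * (3 * c) by lia.
rewrite -!expr2 eqf_sqr => /orP[] /eqP tE; last by lia.
by split=> //; move: tt; rewrite tE; lia.
Qed.

Lemma reduced_isotropic t (s : 'rV[int]_9) : reduced t s ->
  <| lorentz_vec t s : Ipm 1 9, lorentz_vec t s |> = 0 ->
  (t = 3 * s ord0 ord0 /\ s = const_mx (s ord0 ord0)) \/
  exists i, s = t *: delta_mx ord0 i.
Proof.
move=> [s0 s3]; rewrite lorentz_form => /eqP; rewrite subr_eq0 => /eqP ts.
have argmax (P : pred 'I_9) i0 : P i0 ->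
    exists2 i, P i & forall l, P l -> s ord0 l <= s ord0 i.
  by move=> Pi0; case: (arg_maxP (fun l => s ord0 l) Pi0) => i Pi iP; exists i.
have pick2 (i j : 'I_9) : exists k, (k != i) && (k != j).
  have /allPn[k _] : ~~ all (mem [:: i; j]) [:: ord0; inord 1; inord 2].
    apply/negP => /allP/uniq_leq_size; rewrite /= !inE -!val_eqE /= !inordK //.
    by move=> /(_ isT).
  by rewrite /= !inE negb_or; exists k.
(* The indices i, j, k are those of three largest coordinates, in decreasing order. *)
have [i _ iP] := argmax predT ord0 isT.
have [j0 /andP[j0i _]] := pick2 i i.
have [j ji jP] := argmax (fun l => l != i) j0 j0i.
have [k0 k0ij] := pick2 i j.
have [k /andP[ki kj] kP] := argmax (fun l => (l != i) && (l != j)) k0 k0ij.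
have [ij ik jk] : [/\ i != j, i != k & j != k] by rewrite ![_ == k]eq_sym [i == _]eq_sym.
have le3 := s3 i j k ij ik jk.
have jle : s ord0 j <= s ord0 i by apply: iP.
have kle : s ord0 k <= s ord0 j by apply: jP.
pose c := s ord0 k.
(* The squares of the six other coordinates are at most c^2, with total deficit S; together with the
   coordinate k itself they contribute 7 c^2 - S to t^2. *)
pose G l := c * c - s ord0 l * s ord0 l.
have G0 l : [&& l != i, l != j & l != k] -> 0 <= G l.
  move=> /and3P[li lj _]; rewrite /G subr_ge0; apply: ler_pM; rewrite ?s0 //.
    by apply: kP; rewrite li lj.
  by apply: kP; rewrite li lj.
have GE : \sum_l G l = 9 * (c * c) - t * t.
  by rewrite sumrB sumr_const card_ord ts mulr_natl.
rewrite (sum_sub3 _ ij ik jk) in GE.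
set S := \sum_(l | _) _ in GE.
have S0 : 0 <= S by apply: sumr_ge0.
have tt : t * t = s ord0 i * s ord0 i + s ord0 j * s ord0 j + 7 * (c * c) - S.
  by move: GE; rewrite /G -/c; clear; lia.
have [[ck sj ti]|[si sj tc SE]] := norm_bound_equality (s0 k) kle jle S0 tt le3.
  right; exists i.
  have sl l : l != i -> s ord0 l = 0.
    by move=> /jP; rewrite sj => ls; apply: le_anti; rewrite ls s0.
  apply/rowP => l; rewrite !mxE eqxx /=.
  by have [->|/sl->] := eqVneq l i; rewrite ?mulr1 ?mulr0.
left.
have sl l : s ord0 l = c.
  have [->//|li] := eqVneq l i; have [->//|lj] := eqVneq l j; have [->//|lk] := eqVneq l k.
  have /eqP := SE; rewrite /S psumr_eq0 // => /allP/(_ l); rewrite mem_index_enum li lj lk.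
  move=> /(_ isT); rewrite subr_eq0 -!expr2 eqf_sqr.
  have := s0 l; have := s0 k; rewrite -/c; move: (c) (s ord0 l); clear => u z.
  by move=> u0 z0 /orP[] /eqP; lia.
by rewrite sl; split=> //; apply/rowP => l; rewrite mxE sl.
Qed.

(** The names refer to the parity of u^perp / u. All coordinates of (3; 1, ..., 1) are odd, so that
    vector is characteristic and its complement is even; the complement of (1; 1, 0, ..., 0)
    contains vectors of norm -1. *)
Definition lorentz_odd : 'rV[int]_(1 + 9) := lorentz_vec 1 (delta_mx ord0 ord0).
Definition lorentz_even : 'rV[int]_(1 + 9) := lorentz_vec 3 (const_mx 1).

Lemma equivalent_lorentz (u : Ipm 1 9) : primitive_isotropic_vector (Ipm 1 9) u ->
  equivalent u (lorentz_odd : Ipm 1 9) \/ equivalent u (lorentz_even : Ipm 1 9).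
Proof.
move=> [u0 uu pu]; have [t [s [us red]]] := equivalent_reduced uu.
have [g gi gv] := us.
have [w0 ww pw] : primitive_isotropic_vector (Ipm 1 9) (lorentz_vec t s).
  by rewrite -gv; apply: primitive_isotropic_isometry.
have unit_coef k t' s' : 0 <= k -> lorentz_vec t s = k *: lorentz_vec t' s' -> k = 1.
  move=> k0 e; have := pw k (lorentz_vec t' s'); rewrite -scaler_int intz => /(_ e).
  by rewrite ger0_norm.
have t_ge0 : 0 <= t.
  have := red.2 ord0 (inord 1) (inord 2).
  rewrite -!val_eqE /= !inordK // => /(_ isT isT isT); apply: le_trans.
  by rewrite !addr_ge0 ?red.1.
have [[tE sE]|[i sE]] := reduced_isotropic red ww.
  right; apply: (equivalent_trans us).
  have c1 : s ord0 ord0 = 1.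
    apply: (unit_coef _ 3 (const_mx 1)); first exact: red.1.
    rewrite lorentz_vecZ; congr lorentz_vec; first by rewrite [LHS]tE mulrC.
    by rewrite {1}sE; apply/rowP => l; rewrite !mxE mulr1.
  by rewrite tE c1 mulr1 sE c1; apply: equivalent_refl.
left; apply: (equivalent_trans us).
have t1 : t = 1.
  apply: (unit_coef _ 1 (delta_mx ord0 i)) => //.
  by rewrite lorentz_vecZ mulr1 -sE.
rewrite sE t1 scale1r /lorentz_odd.
have [->|i0] := eqVneq i ord0; first exact: equivalent_refl.
(* The reflection in this root of norm -2 exchanges the coordinates i and 0. *)
pose r := lorentz_vec 0 (delta_mx ord0 i - delta_mx ord0 ord0).
have dE (z : 'rV[int]_9) :
    \sum_j (delta_mx ord0 i - delta_mx ord0 ord0 : 'rV_9) ord0 j * z ord0 j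
    = z ord0 i - z ord0 ord0.
  rewrite (bigD1 i) //= (bigD1 ord0) 1?eq_sym //= big1 => [|j /andP[ji j0]].
    by rewrite !mxE !eqxx [ord0 == i]eq_sym (negPf i0) /=; ring.
  by rewrite !mxE (negPf ji) (negPf j0) andbF mul0r.
exists (@reflection (Ipm 1 9) r (-1)).
  apply: reflection_isometry; rewrite lorentz_form dE !mxE !eqxx [ord0 == i]eq_sym.
  by rewrite (negPf i0).
rewrite /reflection lorentz_form dE -scaleNr lorentz_vecZ lorentz_vecD; congr lorentz_vec.
  by ring.
by apply/rowP => j; rewrite !mxE !eqxx [ord0 == i]eq_sym (negPf i0) /=; ring.
Qed.


End LorentzDescent.

(** * The quotients V^perp / V *)

Lemma inj_surj_bijective (A B : Type) (f : A -> B) :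
  injective f -> (forall y, exists x, f x = y) -> bijective f.
Proof.
move=> fI /choice[g gK]; exists g => // x.
by apply: fI; rewrite gK.
Qed.

(** The map h is a section of V^perp -> V^perp / V up to isometry: surjectivity is the last
    hypothesis, and injectivity comes from the nondegeneracy of A. *)
Lemma perp_quot_isometric (K : lattice) (V : sublattice K) (A : lattice) (h : A -> K) :
  unimodular A -> {morph h : x y / x + y} ->
  (forall x y, <| h x, h y |> = <| x, y |>) ->
  (forall x, h x \in perp V) ->
  (forall x, x \in perp V -> exists y, x - h y \in V) ->
  isometric (perp_quot V) A.
Proof.
move=> uA hD hf hV hs; apply: isometric_sym.
pose k (x : A) : perp_quot V := \pi_(Quotient.quot (@in_perp K V)) (exist _ (h x) (hV x)).
have kE x y : k x = \pi_(Quotient.quot (@in_perp K V)) y <-> h x - val y \in V.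
  rewrite /k; split=> [/eqP|hxy]; last apply/eqP.
    by rewrite -Quotient.idealrBE unfold_in /in_perp raddfB.
  by rewrite -Quotient.idealrBE unfold_in /in_perp raddfB.
exists k; split.
- move=> x y; rewrite /k -[RHS]raddfD; congr (\pi_(Quotient.quot (@in_perp K V)) _).
  by apply: val_inj; rewrite /= hD.
- apply: inj_surj_bijective => [x y /kE /= hxy|z].
    apply/eqP; rewrite -subr_eq0; apply/eqP.
    (* If h x - h y lies in V, it is orthogonal to all of h A, so x - y lies in the radical of A;
       divisibility by 0 expresses this. *)
    have [|m ->] := @unimodular_dvd A uA 0 (x - y); last by rewrite scale0r.
    move=> z; rewrite dvd0z lformC lformB -!hf -lformB lformC.
    by have /asboolP -> := hV z.
  have [y yz] := hs _ (valP (repr z)); exists y; rewrite -[z in RHS]reprK; apply/kE.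
  have [V0 VB] := sl_closed V.
  by rewrite -opprB -sub0r; apply: VB.
- by move=> x y; rewrite perp_quotE hf.
Qed.

(** * Models of the quotients from orthogonal splittings *)

Lemma lattice_sum_form (A B : lattice) x y x' y' :
  <| row_mx x y : lattice_sum A B, row_mx x' y' |> = <| x : A, x' |> + <| y : B, y' |>.
Proof.
by rewrite /= tr_row_mx mul_row_block !mulmx0 addr0 add0r mul_row_col mxE.
Qed.

Lemma row_mxP (m n : nat) (x : 'rV[int]_(m + n)) : exists y z, x = row_mx y z.
Proof. by exists (lsubmx x), (rsubmx x); rewrite hsubmxK. Qed.

Lemma isometryZ (K L : lattice) (g : K -> L) (k : int) (x : 'rV[int]_(lrank K)) :
  isometry g -> g (k *: x) = k *: (g x : 'rV_(lrank L)).
Proof. by move=> gi; rewrite -[k]intz !scaler_int (isometryMz k gi). Qed.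

(* Satisfied by the primitive isotropic vectors of a unimodular lattice of rank 2. *)
Definition hyperbolic_line (A : lattice) (a : 'rV[int]_(lrank A)) : Prop :=
  [/\ <| a : A, a |> = 0, exists d : A, <| a : A, d |> = 1
    & forall x : A, <| x, a |> = 0 -> exists k : int, x = k *: a].

Lemma hyperbolic_line_Ipm : @hyperbolic_line (Ipm 1 1) (const_mx 1).
Proof.
split.
- by rewrite Ipm_formE !big_ord1 !mxE subrr.
- by exists (row_mx 1%:M 0); rewrite Ipm_formE !big_ord1 row_mxEl row_mxEr !mxE.
- move=> x; rewrite Ipm_formE !big_ord1 !mxE !mulr1 => /eqP; rewrite subr_eq0 => /eqP e.
  exists (x ord0 (lshift 1 ord0)); apply/rowP => i; rewrite !mxE mulr1.
  by case: (split_ordP i) => j ->; rewrite (ord1 j) ?e.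
Qed.

Lemma hyperbolic_line_U : @hyperbolic_line hyperbolic_plane (delta_mx ord0 ord0).
Proof.
have fE (x y : 'rV[int]_2) :
    <| x : hyperbolic_plane, y |> = x ord0 ord0 * y ord0 ord_max + x ord0 ord_max * y ord0 ord0.
  rewrite /= mxE !big_ord_recl big_ord0 !mxE !big_ord_recl !big_ord0 !mxE /=.
  have -> : lift ord0 ord0 = ord_max :> 'I_2 by apply: val_inj.
  by ring.
split.
- by rewrite fE !mxE.
- by exists (delta_mx ord0 ord_max); rewrite fE !mxE.
- move=> x; rewrite fE !mxE /= mulr0 mulr1 add0r => e; exists (x ord0 ord0).
  apply/rowP => i; rewrite !mxE; case: (unliftP ord0 i) => [j ->|->]; last by rewrite mulr1.
  by rewrite (ord1 j) mulr0 -e; congr (x _ _); apply: val_inj.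
Qed.

Section VectorModel.
Variables (K A B : lattice) (a : 'rV[int]_(lrank A)).
Hypotheses (al : hyperbolic_line a) (uB : unimodular B).
Variables (g : K -> lattice_sum A B) (v : K).
Hypotheses (gi : isometry g) (gv : g v = row_mx a 0).

Lemma hyperbolic_line_primitive : primitive_isotropic_vector K v.
Proof.
have [aa [d ad] _] := al; have [h [hi gK hK]] := isometry_inv gi.
case: (gi) => gD _ gf; case: (hi) => _ _ hf.
have vd : <| v, h (row_mx d 0) |> = 1 by rewrite -gf gv hK lattice_sum_form lform0l ad addr0.
split.
- by apply: contra_eq_neq vd => ->; rewrite lform0l.
- by rewrite -gf gv lattice_sum_form lform0l aa.
- move=> k w vk; move: vd; rewrite vk -scaler_int intz lformZl.
  exact: mul_eq1_norm.
Qed.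

(** In A + B the complement of a is Za + B, because the complement of a in A is Za. Hence b -> (0,
    b) induces the isometry. *)
Lemma perp_quot_hyperbolic_line : isometric (perp_quot (zspan v)) B.
Proof.
have [aa _ ap] := al; have [h [hi gK hK]] := isometry_inv gi.
case: (gi) => gD _ gf; case: (hi) => hD _ hf.
apply: (@perp_quot_isometric _ _ _ (fun b : 'rV_(lrank B) => h (row_mx 0 b))) => //.
- by move=> x y; rewrite -hD; congr h; rewrite [RHS](add_row_mx 0 x) addr0.
- by move=> x y; rewrite hf lattice_sum_form lform0l add0r.
- move=> x; apply/asboolP => _ /asboolP[k ->]; rewrite -scaler_int lformZr.
  by rewrite -gf hK gv lattice_sum_form !lform0l lform0r mulr0.
- move=> x /asboolP xv; have [y [z gx]] := row_mxP (g x).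
  have yv : <| y : A, a |> = 0.
    rewrite -[LHS]addr0 -[X in _ + X](@lform0r B z) -lattice_sum_form -gx -gv gf.
    by apply: (xv v); apply/asboolP; exists 1.
  have [k yE] := ap y yv; exists z; apply/asboolP; exists k.
  apply: (can_inj gK); rewrite (isometryB gi) hK gx (isometryMz k gi) gv -scaler_int intz.
  by rewrite opp_row_mx add_row_mx scale_row_mx scaler0 subrr oppr0 addr0 yE.
Qed.

End VectorModel.

Lemma int_scalerI (n : nat) (k : int) (x y : 'rV[int]_n) :
  k != 0 -> k *: x = k *: y -> x = y.
Proof.
by move=> k0 /rowP kxy; apply/rowP => i; apply: (mulfI k0); have := kxy i; rewrite !mxE.
Qed.

Lemma row2P (c : 'rV[int]_2) : exists k l, c = row_mx k%:M l%:M :> 'rV_(1 + 1).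
Proof.
have [y [z ->]] := row_mxP (c : 'rV_(1 + 1)); exists (y 0 0), (z 0 0).
by rewrite -!mx11_scalar.
Qed.

Lemma row2_mul (n : nat) (k l : int) (u w : 'rV[int]_n) :
  (row_mx k%:M l%:M : 'rV_(1 + 1)) *m col_mx u w = k *: u + l *: w.
Proof. by rewrite mul_row_col !mul_scalar_mx. Qed.

Definition zplane_pred (K : lattice) (u w : 'rV[int]_(lrank K)) : K -> bool :=
  fun x => `[< exists k l : int, x = k *: u + l *: w >].

Lemma zplane_closed (K : lattice) (u w : 'rV[int]_(lrank K)) :
  zmod_closed (zplane_pred u w : {pred K}).
Proof.
split=> [|x y]; first by apply/asboolP; exists 0, 0; rewrite !scale0r addr0.
move=> /asboolP[k [l ->]] /asboolP[k' [l' ->]]; apply/asboolP; exists (k - k'), (l - l').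
by rewrite !scalerBl opprD addrACA.
Qed.

Definition zplane (K : lattice) (u w : 'rV[int]_(lrank K)) : sublattice K :=
  Sublattice (zplane_closed u w).

Lemma zplaneP (K : lattice) (u w : 'rV[int]_(lrank K)) (x : K) :
  x \in zplane u w <-> exists k l : int, x = k *: u + l *: w.
Proof. by split=> /asboolP. Qed.

(** The vectors d and e are dual to u and w: pairing with them recovers the two coefficients, as
    integers even when only a nonzero multiple of x is known to lie in the plane. *)
Lemma zplane_primitive (K : lattice) (u w d e : 'rV[int]_(lrank K)) :
  <| u : K, u |> = 0 -> <| u : K, w |> = 0 -> <| w : K, w |> = 0 ->
  <| u : K, d |> = 1 -> <| w : K, d |> = 0 ->
  <| u : K, e |> = 0 -> <| w : K, e |> = 1 ->
  primitive_isotropic_plane K (zplane u w).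
Proof.
move=> uu uw ww ud wd ue we; split.
- move=> k x k0 /zplaneP[p [q xk]]; apply/zplaneP; exists <| x, d : K |>, <| x, e : K |>.
  have {}xk : k *: (x : 'rV_(lrank K)) = p *: u + q *: w by rewrite -xk -scaler_int intz.
  apply: (int_scalerI k0); rewrite scalerDr !scalerA -!lformZl xk !lformE ud wd ue we.
  by rewrite !mulr0 !mulr1 add0r addr0.
- move=> x y /zplaneP[p [q ->]] /zplaneP[p' [q' ->]].
  by rewrite !lformE (lformC w u) uu uw ww; ring.
- exists (col_mx u w : 'M_(1 + 1, _)); split.
    move=> c; have [k [l ->]] := row2P c; rewrite row2_mul => yz.
    have /eqP := congr1 (fun x : 'rV_(lrank K) => <| x : K, d |>) yz.
    have /eqP := congr1 (fun x : 'rV_(lrank K) => <| x : K, e |>) yz.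
    rewrite !lformE ud wd ue we !mulr0 !mulr1 add0r addr0 => /eqP -> /eqP ->.
    by rewrite raddf0 row_mx0.
  move=> x; rewrite zplaneP; split=> [[k [l ->]]|[c ->]].
    by exists (row_mx k%:M l%:M : 'rV_(1 + 1)); rewrite row2_mul.
  by have [k [l ->]] := row2P c; exists k, l; rewrite row2_mul.
Qed.

Section PlaneModel.
Variables (K A A' B : lattice) (a : 'rV[int]_(lrank A)) (a' : 'rV[int]_(lrank A')).
Hypotheses (al : hyperbolic_line a) (al' : hyperbolic_line a') (uB : unimodular B).
Variables (g : K -> lattice_sum A (lattice_sum A' B)) (u w : K).
Hypotheses (gi : isometry g).
Hypotheses (gu : g u = row_mx a 0) (gw : g w = row_mx 0 (row_mx a' 0)).

Let sumE := (@lattice_sum_form A (lattice_sum A' B), @lattice_sum_form A' B).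

Lemma hyperbolic_lines_primitive : primitive_isotropic_plane K (zplane u w).
Proof.
have [aa [d ad] _] := al; have [aa' [d' ad'] _] := al'.
have [h [hi gK hK]] := isometry_inv gi; case: (gi) => gD _ gf.
apply: (@zplane_primitive K u w (h (row_mx d 0)) (h (row_mx 0 (row_mx d' 0))));
  rewrite -gf ?hK ?gu ?gw !sumE ?lform0l ?lform0r ?addr0 ?add0r //.
Qed.

Lemma perp_quot_hyperbolic_lines : isometric (perp_quot (zplane u w)) B.
Proof.
have [aa _ ap] := al; have [aa' _ ap'] := al'.
have [h [hi gK hK]] := isometry_inv gi; case: (gi) => gD _ gf; case: (hi) => hD _ hf.
apply: (@perp_quot_isometric _ _ _ (fun b : 'rV_(lrank B) => h (row_mx 0 (row_mx 0 b)))) => //.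
- move=> x y; rewrite -hD; congr h; rewrite [RHS](add_row_mx 0 (row_mx 0 x)).
  by rewrite addr0 add_row_mx addr0.
- by move=> x y; rewrite hf !sumE !lform0l !add0r.
- move=> x; apply/asboolP => _ /zplaneP[k [l ->]]; rewrite !lformE.
  by rewrite -!gf hK gu gw !sumE !lformE !mulr0 addr0.
- move=> x /asboolP xv; have [y [s gx]] := row_mxP (g x); have [y' [z sE]] := row_mxP s.
  rewrite {}sE in gx.
  have xu : <| x, u |> = 0.
    by apply: (xv u); apply/zplaneP; exists 1, 0; rewrite scale1r scale0r addr0.
  have xw : <| x, w |> = 0.
    by apply: (xv w); apply/zplaneP; exists 0, 1; rewrite scale1r scale0r add0r.
  rewrite -gf gx gu sumE lform0r addr0 in xu.
  rewrite -gf gx gw !sumE !lform0r addr0 add0r in xw.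
  have [k yE] := ap y xu; have [l yE'] := ap' y' xw; exists z; apply/zplaneP; exists k, l.
  apply: (can_inj gK); rewrite (isometryB gi) hK gx gD (isometryZ k u gi) (isometryZ l w gi).
  rewrite gu gw.
  have E : row_mx y (row_mx y' z) - row_mx 0 (row_mx 0 z) =
      k *: row_mx a 0 + l *: row_mx 0 (row_mx a' 0) :> 'rV[int]_(_ + (_ + _)).
    rewrite yE yE' !opp_row_mx !add_row_mx !scale_row_mx !scaler0 !oppr0 !addr0 subrr.
    by rewrite !add_row_mx !add0r !addr0.
  exact: E.
Qed.

End PlaneModel.

(** * Orbits of isotropic vectors and planes *)

Lemma equivalent_isometry (K L : lattice) (g : K -> L) (v w : K) :
  isometry g -> equivalent (g v) (g w) -> equivalent v w.
Proof.
move=> gi [k ki kv]; have [h [hi gK hK]] := isometry_inv gi.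
exists (h \o (k \o g)); first exact/(isometry_comp hi)/(isometry_comp ki).
by rewrite /= kv gK.
Qed.

Lemma Ipm_2_10_equivalent (v w : Ipm 2 10) :
  primitive_isotropic_vector (Ipm 2 10) v -> primitive_isotropic_vector (Ipm 2 10) w ->
  (characteristic v <-> characteristic w) -> equivalent v w.
Proof.
move=> pv pw vw.
(* Positions 0 and 1 have norm 1, the others -1. Within each pair e, f and e', f' the vectors share
   one positive basis vector and use different negative ones; n is a negative basis vector used by
   neither pair. Entries past the end of a list are 0. *)
pose e := seq_row 12 [:: 1; 0; 1].
pose f := seq_row 12 [:: 1; 0; 0; 1].
pose e' := seq_row 12 [:: 0; 1; 0; 0; 1].
pose f' := seq_row 12 [:: 0; 1; 0; 0; 0; 1].
pose s := seq_row 12 (nseq 12 1).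
pose n := seq_row 12 [:: 0; 0; 0; 0; 0; 0; 1].
have formE (x y : seq int) := @Ipm_seq_row 2 10 x y.
have u := Ipm_unimodular 2 10.
have cs : characteristic (s : Ipm 2 10).
  have -> : s = const_mx 1 by apply/rowP => i; rewrite !mxE nth_nseq ltn_ord.
  exact: (@characteristic_Ipm 2 10).
have [cv|cv] := pselect (characteristic v).
  have orbit x : primitive_isotropic_vector (Ipm 2 10) x -> characteristic x ->
      equivalent x (2 *: e' + 2 *: f' + s : Ipm 2 10).
    move=> px cx; apply: (@equivalent_characteristic (Ipm 2 10) e f e' f' _ _ _ _ _ _ _ _ _ _ u s n) => //;
      by apply: (etrans (formE _ _)); vm_compute.
  apply: (equivalent_trans (orbit v pv cv)); apply: equivalent_sym.
  exact: (orbit w pw (vw.1 cv)).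
have orbit x : primitive_isotropic_vector (Ipm 2 10) x -> ~ characteristic x ->
    equivalent x (e' : Ipm 2 10).
  move=> px cx; apply: (@equivalent_noncharacteristic (Ipm 2 10) e f e' f') => //;
    by apply: (etrans (formE _ _)); vm_compute.
apply: (equivalent_trans (orbit v pv cv)); apply: equivalent_sym.
by apply: (orbit w pw) => /vw.2.
Qed.

Lemma equivalent_characteristicP (K : lattice) (v w : K) :
  equivalent v w -> characteristic v -> characteristic w.
Proof. by move=> [g gi <-] cv; apply/(characteristic_isometry v gi). Qed.

Section Orbits.
Variable K : lattice.
Hypothesis hK : isometric K (Ipm 2 10).

Lemma isotropic_equivalent (v w : K) :
  primitive_isotropic_vector K v -> primitive_isotropic_vector K w ->
  (characteristic v <-> characteristic w) -> equivalent v w.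
Proof.
have [g gi] := hK => pv pw vw; apply: (equivalent_isometry gi).
apply: Ipm_2_10_equivalent; [exact: primitive_isotropic_isometry ..|].
by rewrite !(characteristic_isometry _ gi).
Qed.

Lemma odd_model : exists g : K -> lattice_sum (Ipm 1 1) (Ipm 1 9), isometry g.
Proof. exact/(isometric_trans hK)/isometric_sym/Ipm_2_10_odd_splitting. Qed.

Lemma odd_model2 :
  exists g : K -> lattice_sum (Ipm 1 1) (lattice_sum (Ipm 1 1) (Ipm 0 8)), isometry g.
Proof. exact/(isometric_trans hK)/isometric_sym/Ipm_2_10_odd_splitting2. Qed.

Lemma even_model : exists g : K -> lattice_sum (Ipm 1 1) II_1_9, isometry g.
Proof. exact/(isometric_trans hK)/isometric_sym/Ipm_2_10_even_splitting. Qed.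

Lemma isometry_unimodular (A B : lattice) (g : A -> B) :
  isometry g -> unimodular B -> forall (d : int) (z : 'rV[int]_(lrank A)),
  (forall x : A, (d %| <| x, z : A |>)%Z) -> exists m, z = d *: m.
Proof.
move=> gi uB d z dz; have [h [hi gK hK']] := isometry_inv gi; case: (gi) => _ _ gf.
have [x|m gm] := @unimodular_dvd B uB d (g z); first by rewrite -[x]hK' gf.
by exists (h m); rewrite -[z]gK gm isometryZ.
Qed.

Lemma row_mx_noncharacteristic (A B : lattice) (a : 'rV[int]_(lrank A)) (b : B) :
  ~~ (2 %| <| b, b |>)%Z -> ~ characteristic (row_mx a 0 : lattice_sum A B).
Proof.
move=> ob /(_ (row_mx 0 b)); rewrite !lattice_sum_form !lform0l lform0r !add0r subr0.
exact/negP.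
Qed.

Lemma row_mx_characteristic (A B : lattice) (a : 'rV[int]_(lrank A)) :
  characteristic (a : A) -> even_lattice B ->
  characteristic (row_mx a 0 : lattice_sum A B).
Proof.
move=> ca eB x; have [y [z ->]] := row_mxP x; rewrite !lattice_sum_form lform0r addr0.
by rewrite addrAC rpredD //; apply: eB.
Qed.

Definition same_orbit (V W : sublattice K) : Prop :=
  exists2 g, isometry_group K g & [set` W] = g @` [set` V].

Lemma same_orbit_refl (U : sublattice K) : same_orbit U U.
Proof. by exists id; [apply: isometry_id | rewrite image_id]. Qed.

Lemma same_orbit_trans (U V W : sublattice K) :
  same_orbit U V -> same_orbit V W -> same_orbit U W.
Proof.
move=> [g gi gU] [h hi hV]; exists (h \o g); first exact: isometry_comp.
by rewrite hV gU image_comp.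
Qed.

Lemma same_orbit_sym (V W : sublattice K) : same_orbit V W -> same_orbit W V.
Proof.
move=> [g /isometry_inv[h [hi gK _]] gV]; exists h => //.
by rewrite gV image_comp (_ : h \o g = id) ?image_id //; apply/funext/gK.
Qed.

Lemma sublattice_orbitP (V W : sublattice K) :
  sublattice_orbit V = sublattice_orbit W <-> same_orbit V W.
Proof.
split=> [VW|VW].
  by have : sublattice_orbit W W by [exact: same_orbit_refl]; rewrite -VW.
apply/seteqP; split=> U; last exact: same_orbit_trans.
exact/same_orbit_trans/same_orbit_sym.
Qed.

(** Some isometry carries V to the span of the isotropic vector (1; 1) of I_{1,1} and of u in
    I_{1,9}; u alone then determines the orbit of V. *)
Definition model_plane (u : 'rV[int]_(1 + 9)) (V : sublattice K) : Prop :=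
  exists2 g : K -> lattice_sum (Ipm 1 1) (Ipm 1 9), isometry g &
    forall x, x \in V <-> exists k l : int, g x = row_mx (k *: const_mx 1) (l *: u).

Lemma model_plane_orbit u (V W : sublattice K) :
  model_plane u V -> model_plane u W -> same_orbit V W.
Proof.
move=> [g gi gV] [g' gi' gW]; have [h [hi gK hK']] := isometry_inv gi'.
exists (h \o g); first exact: isometry_comp.
apply/seteqP; split=> x.
  move=> /gW[k [l xE]]; have [f [fi gf fg]] := isometry_inv gi; exists (f (g' x)) => /=.
    by apply/gV; exists k, l; rewrite fg.
  by rewrite fg gK.
by move=> [y /gV[k [l yE]] <-]; apply/gW; exists k, l; rewrite /= hK'.
Qed.

Lemma row_sum_isometry (A B : lattice) (h : B -> B) : isometry h ->
  exists2 g : lattice_sum A B -> lattice_sum A B, isometry g &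
    forall (y : 'rV[int]_(lrank A)) (z : 'rV[int]_(lrank B)),
      g (row_mx y z) = row_mx y (h z : 'rV_(lrank B)).
Proof.
move=> hi; have [h' [hi' hK1 hK2]] := isometry_inv hi; case: (hi) => hD _ hf.
pose g (k : B -> B) (x : 'rV[int]_(lrank A + lrank B)) :=
  row_mx (lsubmx x) (k (rsubmx x) : 'rV_(lrank B)).
have gE k y z : g k (row_mx y z) = row_mx y (k z : 'rV_(lrank B)).
  by rewrite /g row_mxKl row_mxKr.
exists (g h); last exact: gE.
split.
- move=> x y; have [x1 [x2 ->]] := row_mxP x; have [y1 [y2 ->]] := row_mxP y.
  rewrite [_ + row_mx y1 y2](add_row_mx x1 x2) !gE [RHS](add_row_mx x1).
  by congr row_mx; apply: hD.
- by exists (g h') => x; have [x1 [x2 ->]] := row_mxP x; rewrite !gE ?hK1 ?hK2.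
- move=> x y; have [x1 [x2 ->]] := row_mxP x; have [y1 [y2 ->]] := row_mxP y.
  by rewrite !gE !lattice_sum_form hf.
Qed.

(** * Bases and normal forms of primitive isotropic planes *)

Definition plane_basis (V : sublattice K) (u w : 'rV[int]_(lrank K)) : Prop :=
  (forall k l : int, k *: u + l *: w = 0 -> k = 0 /\ l = 0) /\
  forall x : K, x \in V <-> exists k l : int, x = k *: u + l *: w.

Lemma plane_basis_exists (V : sublattice K) : has_rank V 2 -> exists u w, plane_basis V u w.
Proof.
move=> [b [bI bV]]; pose b' : 'M_(1 + 1, lrank K) := b.
have bE k l : (row_mx k%:M l%:M : 'rV_(1 + 1)) *m b = k *: usubmx b' + l *: dsubmx b'.
  by rewrite -row2_mul vsubmxK.
exists (usubmx b'), (dsubmx b'); split=> [k l|x].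
  rewrite -bE => /bI kl; split.
    have := congr1 (fun x : 'rV_(1 + 1) => x ord0 (lshift 1 ord0)) kl.
    by rewrite row_mxEl !mxE.
  have := congr1 (fun x : 'rV_(1 + 1) => x ord0 (rshift 1 ord0)) kl.
  by rewrite row_mxEr !mxE.
rewrite bV; split=> [[c ->]|[k [l ->]]].
  by have [k [l ->]] := row2P c; exists k, l; rewrite bE.
by exists (row_mx k%:M l%:M : 'rV_(1 + 1)); rewrite bE.
Qed.

Lemma plane_basisC V u w : plane_basis V u w -> plane_basis V w u.
Proof.
move=> [uw Vuw]; split=> [k l|x]; first by rewrite addrC => /uw[].
by rewrite Vuw; split=> -[k [l ->]]; exists l, k; rewrite addrC.
Qed.

Lemma plane_basis_shear V u w k : plane_basis V u w -> plane_basis V u (w - k *: u).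
Proof.
have shear (p q : int) : p *: u + q *: (w - k *: u) = (p - q * k) *: u + q *: w.
  by rewrite scalerBr scalerBl scalerA addrAC addrA.
move=> [uw Vuw]; split=> [p q|x].
  by rewrite shear => /uw[+ q0]; rewrite q0 mul0r subr0.
rewrite Vuw; split=> -[p [q ->]]; last by exists (p - q * k), q; rewrite shear.
by exists (p + q * k), q; rewrite shear addrK.
Qed.

Lemma plane_basis_left V u w : plane_basis V u w -> (u : K) \in V.
Proof. by move=> [_ Vuw]; apply/Vuw; exists 1, 0; rewrite scale1r scale0r addr0. Qed.

(** As V is primitive it contains z; writing z in the basis and comparing the coefficients of u in u
    = k z shows that k is a unit. *)
Lemma plane_basis_primitive V u w (z : 'rV[int]_(lrank K)) (k : int) :
  primitive_sublattice V -> plane_basis V u w -> u = k *: z -> exists l, k * l = 1.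
Proof.
move=> pV uwV uz; have [uw Vuw] := uwV.
have k0 : k != 0.
  apply/eqP => k0; have [] := uw 1 0; last by [].
  by rewrite uz k0 !scale0r scaler0 addr0.
have /Vuw[p [q zE]] : (z : K) \in V.
  by apply: (pV k) => //; rewrite -scaler_int intz -uz; apply: plane_basis_left uwV.
exists p; have [|kp _] := uw (1 - k * p) (- (k * q)).
  rewrite scalerBl scale1r scaleNr -!scalerA -addrA -opprD -scalerDr -zE -uz.
  exact: subrr.
by apply/eqP; rewrite eq_sym -subr_eq0 kp.
Qed.

Lemma plane_basis_isotropic_vector V u w :
  primitive_sublattice V -> isotropic_sublattice V -> plane_basis V u w ->
  primitive_isotropic_vector K u.
Proof.
move=> pV iV uwV; split.
- apply/eqP => u0; have [] := uwV.1 1 0; last by [].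
  by rewrite u0 scaler0 scale0r addr0.
- by apply: iV; apply: plane_basis_left uwV.
- move=> k z; rewrite -scaler_int intz => /(plane_basis_primitive pV uwV)[l].
  exact: mul_eq1_norm.
Qed.

Lemma plane_basis_noncharacteristic V u w :
  primitive_sublattice V -> plane_basis V u w ->
  characteristic (u : K) -> characteristic (w : K) -> False.
Proof.
move=> pV uwV cu cw; have [g gi] := hK.
have [x|m uw2] := isometry_unimodular gi (Ipm_unimodular 2 10) (d := 2) (z := u - w).
  rewrite lformDr lformNr.
  rewrite (_ : _ - _ = (<| x, x |> - <| x, w : K |>) - (<| x, x |> - <| x, u : K |>)); last ring.
  by rewrite rpredB.
(* The difference u - w belongs to a basis of V, so it cannot be divisible by 2. *)
have /plane_basisC := plane_basis_shear 1 (plane_basisC uwV); rewrite scale1r => bV.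
by have [l] := plane_basis_primitive pV bV uw2; lia.
Qed.

Lemma plane_classification (V : sublattice K) : primitive_isotropic_plane K V ->
  model_plane lorentz_odd V \/ model_plane lorentz_even V.
Proof.
move=> [pV iV /plane_basis_exists[u0 [w0 b0]]].
have [u [w [uwV ncu]]] : exists u w, plane_basis V u w /\ ~ characteristic (u : K).
  have [cu|cu] := pselect (characteristic (u0 : K)); last by exists u0, w0.
  have [cw|cw] := pselect (characteristic (w0 : K)).
    by case: (plane_basis_noncharacteristic pV b0 cu cw).
  by exists w0, u0; split=> //; apply: plane_basisC.
have pu := plane_basis_isotropic_vector pV iV uwV.
have [g0 g0i] := odd_model; have [h0 [h0i g0K h0K]] := isometry_inv g0i.
pose a : 'rV[int]_(1 + 1) := const_mx 1.
have ap : primitive_isotropic_vector K (h0 (row_mx a 0)).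
  by apply: (hyperbolic_line_primitive hyperbolic_line_Ipm g0i); rewrite h0K.
have anc : ~ characteristic (h0 (row_mx a 0)).
  rewrite -(characteristic_isometry _ g0i) h0K.
  apply: (row_mx_noncharacteristic (b := lorentz_vec 1 0 : Ipm 1 9)).
  by rewrite lorentz_form big1 // => j _; rewrite !mxE mul0r.
have [k ki ku] : equivalent (u : K) (h0 (row_mx a 0)) by apply: isotropic_equivalent.
pose g1 := g0 \o k; have g1i : isometry g1 by apply: isometry_comp.
have g1u : g1 u = row_mx a 0 by rewrite /g1 /= ku h0K.
case: (g1i) => g1D _ g1f.
have [p [q g1w]] := row_mxP (g1 w : 'rV_(1 + 1 + (1 + 9))).
have [_ _ al] := hyperbolic_line_Ipm.
(* Since V is isotropic, the I_{1,1} component p of the second vector is orthogonal to a, hence a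
   multiple of a; subtracting that multiple of u leaves a vector of I_{1,9}. *)
have pa : <| p : Ipm 1 1, a |> = 0.
  rewrite -[LHS]addr0 -[X in _ + X](@lform0r (Ipm 1 9) q) -lattice_sum_form -g1w -g1u g1f.
  by apply: iV; [apply/(plane_basis_left (plane_basisC uwV)) | apply: plane_basis_left uwV].
have [k0 pE] := al p pa.
pose w1 := w - k0 *: u.
have b1 : plane_basis V u w1 by apply: plane_basis_shear.
have g1w1 : g1 w1 = row_mx 0 q.
  rewrite (isometryB g1i) (isometryZ k0 u g1i) g1w g1u.
  have E : row_mx p q - k0 *: row_mx a 0 = row_mx 0 q :> 'rV[int]_(1 + 1 + (1 + 9)).
    by rewrite scale_row_mx opp_row_mx add_row_mx pE subrr scaler0 subr0.
  exact: E.
have pw1 := plane_basis_isotropic_vector pV iV (plane_basisC b1).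
have pq : primitive_isotropic_vector (Ipm 1 9) q.
  have [w10 w1w1 pw] := primitive_isotropic_isometry g1i pw1; rewrite g1w1 in w10 w1w1 pw.
  split; first by apply: contra w10 => /eqP->; rewrite row_mx0.
    by rewrite -w1w1 lattice_sum_form lform0l add0r.
  move=> l z qz; apply: (pw l (row_mx 0 z : 'rV_(1 + 1 + (1 + 9)))).
  rewrite -scaler_int intz qz -scaler_int intz.
  by rewrite [RHS](scale_row_mx l (0 : 'rV_(1 + 1)) z) scaler0.
(* An isometry of I_{1,9} extends by the identity on I_{1,1}, so q may be replaced by its normal
   form. *)
suff key (r : 'rV[int]_(1 + 9)) : equivalent (q : Ipm 1 9) r -> model_plane r V.
  by case: (equivalent_lorentz pq) => /key; [left | right].
move=> [h hi hq]; have [H Hi HE] := @row_sum_isometry (Ipm 1 1) (Ipm 1 9) h hi.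
have HD : forall x y, H (x + y) = H x + H y by case: Hi.
exists (H \o g1); first exact: isometry_comp.
have E l m : H (g1 (l *: u + m *: w1)) = row_mx (l *: a) (m *: r).
  rewrite g1D (isometryZ l u g1i) (isometryZ m w1 g1i) g1u g1w1 HD (isometryZ l _ Hi) (isometryZ m _ Hi).
  rewrite !HE hq (isometry0 hi).
  have E : l *: row_mx a 0 + m *: row_mx 0 r = row_mx (l *: a) (m *: r)
      :> 'rV[int]_(1 + 1 + (1 + 9)).
    by rewrite !scale_row_mx add_row_mx !scaler0 add0r addr0.
  exact: E.
move=> x; rewrite b1.2; split=> [[l [m ->]]|[l [m xE]]]; exists l, m; first exact: E.
have Gi : isometry (H \o g1) by apply: isometry_comp.
have [f [_ Gf _]] := isometry_inv Gi.
by apply: (can_inj Gf); rewrite xE /= E.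
Qed.

(** Both representatives are (1; 1) in the summand I_{1,1} of a splitting. With complement II_{1,9}
    it is characteristic because that lattice is even; with I_{1,9} it is not, because of a vector
    of norm 1. *)
Lemma isotropic_vector_classification : exists v0 v1 : K,
  [/\ primitive_isotropic_vector K v0 /\ isometric (perp_quot (zspan v0)) (Ipm 1 9),
      primitive_isotropic_vector K v1 /\ isometric (perp_quot (zspan v1)) II_1_9,
      vector_orbit v0 <> vector_orbit v1
    & isotropic_vector_orbits K = [set vector_orbit v0; vector_orbit v1]].
Proof.
have [g0 g0i] := odd_model; have [h0 [h0i g0K h0K]] := isometry_inv g0i.
have [g1 g1i] := even_model; have [h1 [h1i g1K h1K]] := isometry_inv g1i.
have [eII uII _] := II_1_9_spec.
pose v0 := h0 (row_mx (const_mx 1) 0); pose v1 := h1 (row_mx (const_mx 1) 0).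
have p0 : primitive_isotropic_vector K v0.
  by apply: (hyperbolic_line_primitive hyperbolic_line_Ipm g0i); rewrite h0K.
have p1 : primitive_isotropic_vector K v1.
  by apply: (hyperbolic_line_primitive hyperbolic_line_Ipm g1i); rewrite h1K.
have c0 : ~ characteristic v0.
  rewrite -(characteristic_isometry _ g0i) h0K.
  apply: (row_mx_noncharacteristic (b := lorentz_vec 1 0 : Ipm 1 9)).
  by rewrite lorentz_form big1 // => j _; rewrite !mxE mul0r.
have c1 : characteristic v1.
  rewrite -(characteristic_isometry _ g1i) h1K.
  exact: (row_mx_characteristic (@characteristic_Ipm 1 1)).
exists v0, v1; split.
- split=> //; apply: (perp_quot_hyperbolic_line hyperbolic_line_Ipm _ g0i).
    exact: Ipm_unimodular.
  by rewrite h0K.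
- by split=> //; apply: (perp_quot_hyperbolic_line hyperbolic_line_Ipm _ g1i); rewrite ?h1K.
- by move=> /vector_orbitP/equivalent_sym/equivalent_characteristicP/(_ c1).
- apply/seteqP; split=> [_ [v pv <-]|_ [->|->]]; [|by exists v0|by exists v1].
  have [cv|cv] := pselect (characteristic v); [right|left]; apply/vector_orbitP.
    exact: isotropic_equivalent.
  exact: isotropic_equivalent.
Qed.

Lemma isotropic_plane_classification : exists V0 V1 : sublattice K,
  [/\ primitive_isotropic_plane K V0 /\ isometric (perp_quot V0) (lattice_neg E8),
      primitive_isotropic_plane K V1 /\ isometric (perp_quot V1) (Ipm 0 8),
      sublattice_orbit V0 <> sublattice_orbit V1
    & isotropic_plane_orbits K = [set sublattice_orbit V0; sublattice_orbit V1]].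
Proof.
have [g0 g0i] := even_model; have [h0 [h0i g0K h0K]] := isometry_inv g0i.
have [g1 g1i] := odd_model2; have [h1 [h1i g1K h1K]] := isometry_inv g1i.
have [eII _ _] := II_1_9_spec.
pose a : 'rV[int]_(1 + 1) := const_mx 1.
pose u0 := h0 (row_mx a 0); pose w0 := h0 (row_mx 0 (row_mx (delta_mx ord0 ord0) 0)).
pose u1 := h1 (row_mx a 0); pose w1 := h1 (row_mx 0 (row_mx a 0)).
have gu0 : g0 u0 = row_mx a 0 by rewrite h0K.
have gw0 : g0 w0 = row_mx 0 (row_mx (delta_mx ord0 ord0) 0) by rewrite h0K.
have gu1 : g1 u1 = row_mx a 0 by rewrite h1K.
have gw1 : g1 w1 = row_mx 0 (row_mx a 0) by rewrite h1K.
pose V0 := zplane u0 w0; pose V1 := zplane u1 w1.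
have p0 : primitive_isotropic_plane K V0.
  exact: (hyperbolic_lines_primitive hyperbolic_line_Ipm hyperbolic_line_U g0i gu0 gw0).
have p1 : primitive_isotropic_plane K V1.
  exact: (hyperbolic_lines_primitive hyperbolic_line_Ipm hyperbolic_line_Ipm g1i gu1 gw1).
have V01 : sublattice_orbit V0 <> sublattice_orbit V1.
  move=> /sublattice_orbitP[g gi gV].
  have : (g @` [set` V0]) (g u0).
    by exists u0 => //; apply/zplaneP; exists 1, 0; rewrite scale1r scale0r addr0.
  rewrite -gV => /zplaneP[k [l gE]].
  have : characteristic (g u0).
    rewrite (characteristic_isometry _ gi) -(characteristic_isometry _ g0i) gu0.
    exact: (row_mx_characteristic (@characteristic_Ipm 1 1)).
  (* This vector of norm -1 in I_{0,8} is orthogonal to V1, so V1 contains no characteristic vector,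
     whereas u0 is one. *)
  pose b : 'rV[int]_8 := delta_mx ord0 ord0.
  rewrite -(characteristic_isometry _ g1i) => /(_ (row_mx 0 (row_mx 0 b))).
  case: (g1i) => g1D _ _.
  rewrite gE g1D (isometryZ k u1 g1i) (isometryZ l w1 g1i) gu1 gw1 !lformE.
  rewrite !(@lattice_sum_form (Ipm 1 1) (lattice_sum (Ipm 1 1) (Ipm 0 8))).
  rewrite !(@lattice_sum_form (Ipm 1 1) (Ipm 0 8)) !lformE !mulr0 !add0r subr0.
  rewrite Ipm_formE big_ord0 (bigD1 ord0) //= big1 => [|j j0].
    by rewrite mxE.
  by rewrite mxE (_ : rshift 0 j = j) ?(negPf j0) ?mul0r //; apply: val_inj.
have all_orbits V : primitive_isotropic_plane K V ->
    same_orbit V V0 \/ same_orbit V V1.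
  move=> /plane_classification; have := plane_classification p0.
  have := plane_classification p1.
  (* The inequivalent planes V0 and V1 have different models among the two available, so every plane
     shares its model with one of them. *)
  have clash u : model_plane u V0 -> model_plane u V1 -> False.
    by move=> /model_plane_orbit m0 /m0/sublattice_orbitP.
  move=> [] m1 [] m0 [] m; try by case: (clash _ m0 m1).
  - by right; apply: model_plane_orbit m m1.
  - by left; apply: model_plane_orbit m m0.
  - by left; apply: model_plane_orbit m m0.
  - by right; apply: model_plane_orbit m m1.
exists V0, V1; split=> //.
- split=> //; apply: (perp_quot_hyperbolic_lines hyperbolic_line_Ipm hyperbolic_line_U
    _ g0i gu0 gw0).
  exact/neg_unimodular/E8_unimodular.
- split=> //; apply: (perp_quot_hyperbolic_lines hyperbolic_line_Ipm hyperbolic_line_Ipm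
    _ g1i gu1 gw1).
  exact: Ipm_unimodular.
- apply/seteqP; split=> [_ [V pV <-]|_ [->|->]]; [|by exists V0|by exists V1].
  by case: (all_orbits V pV) => /sublattice_orbitP; [left | right].
Qed.

End Orbits.

(** * Boundary components *)

Section SublatticeClosure.
Variables (K : lattice) (V : sublattice K).

Lemma sublattice0 : (0 : K) \in V.
Proof. by have [] := sl_closed V. Qed.

Lemma sublatticeB (x y : K) : x \in V -> y \in V -> x - y \in V.
Proof. by have [_ VB] := sl_closed V; apply: VB. Qed.

Lemma sublatticeN (x : K) : x \in V -> - x \in V.
Proof. by move=> xV; rewrite -sub0r sublatticeB ?sublattice0. Qed.

Lemma sublatticeD (x y : K) : x \in V -> y \in V -> x + y \in V.
Proof. by move=> xV yV; rewrite -[y]opprK sublatticeB ?sublatticeN. Qed.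

Lemma sublatticeZ (k : int) (x : 'rV[int]_(lrank K)) :
  (x : K) \in V -> (k *: x : K) \in V.
Proof.
move=> xV; have VM n : (x *+ n : K) \in V.
  by elim: n => [|n IH]; rewrite ?mulr0n ?sublattice0 // mulrS sublatticeD.
by rewrite -[k]intz scaler_int; case: k => n; rewrite ?NegzE ?mulrNz ?sublatticeN -?pmulrn.
Qed.

Lemma sublattice_mulmx (r : nat) (c : 'rV[int]_r) (b : 'M[int]_(r, lrank K)) :
  (forall i, (row i b : K) \in V) -> (c *m b : K) \in V.
Proof.
move=> bV; rewrite mulmx_sum_row.
apply: (big_ind (fun x : 'rV_(lrank K) => (x : K) \in V)).
- exact: sublattice0.
- by move=> x y; apply: sublatticeD.
- by move=> i _; apply/sublatticeZ/bV.
Qed.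

End SublatticeClosure.

Lemma rat_row_denominator (r : nat) (D : 'rV[rat]_r) :
  exists2 k : int, k != 0 & exists c : 'rV[int]_r, k%:~R *: D = map_mx intr c.
Proof.
pose k := \prod_i denq (D 0 i).
exists k; first by apply/prodf_neq0 => i _; apply: denq_neq0.
exists (\row_i (numq (D 0 i) * \prod_(j | j != i) denq (D 0 j))).
apply/rowP => i; rewrite !mxE /k (bigD1 i) //= !rmorphM /= mulrAC; congr (_ * _).
by rewrite -[X in _ * X]divq_num_den mulrC divfK // intr_eq0 denq_neq0.
Qed.

(** An integral linear system solvable over R is solvable over Q. Clearing denominators puts a
    nonzero multiple of x in W, and primitivity gives x itself. *)
Lemma real_span_integral (R : realType) (K : lattice) (W : sublattice K) (x : K) :
  primitive_sublattice W -> scalar_ext R W (map_mx intr (x : 'rV_(lrank K))) -> x \in W.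
Proof.
move=> pW [r [b [c [bW xE]]]].
have intr_ratr (p q : nat) (M : 'M[int]_(p, q)) :
    map_mx intr M = map_mx (ratr : rat -> R) (map_mx intr M).
  by apply/matrixP => i j; rewrite !mxE ratr_int.
have /submxP[D xD] : (map_mx intr (x : 'rV_(lrank K)) <= (map_mx intr b : 'M[rat]_(_, _)))%MS.
  by rewrite -(map_submx (ratr : {rmorphism rat -> R})) -!intr_ratr xE submxMl.
have [k k0 [d dE]] := rat_row_denominator D.
apply: (pW k) => //; rewrite -scaler_int intz.
have -> : k *: (x : 'rV_(lrank K)) = d *m b.
  have /rowP xd : map_mx intr (k *: (x : 'rV_(lrank K))) = map_mx (intr : int -> rat) (d *m b).
    by rewrite map_mxM -dE -scalemxAl -xD map_mxZ.
  by apply/rowP => i; have := xd i; rewrite !mxE => /intr_inj.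
exact: sublattice_mulmx.
Qed.

(** * Action of isometries on complex points and their boundary components *)

Section IsometryMatrix.
Variable K : lattice.

Definition isometry_mx (g : K -> K) : 'M[int]_(lrank K) :=
  lin1_mx (g : 'rV_(lrank K) -> 'rV_(lrank K)).

Lemma isometry_mxE (g : K -> K) (x : 'rV[int]_(lrank K)) :
  isometry g -> g x = x *m isometry_mx g.
Proof.
move=> gi; case: (gi) => gD _ _; rewrite {1}(row_sum_delta x) mulmx_sum_row.
rewrite (big_morph (g : 'rV_(lrank K) -> 'rV_(lrank K)) gD (isometry0 gi)).
apply: eq_bigr => i _; rewrite (isometryZ _ _ gi); congr (_ *: _).
by apply/rowP => j; rewrite !mxE.
Qed.

Lemma isometry_mx_comp (g h : K -> K) : isometry g -> isometry h ->
  isometry_mx (g \o h) = isometry_mx h *m isometry_mx g.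
Proof.
move=> gi hi; apply/row_matrixP => i; rewrite !rowE mulmxA.
by rewrite -!isometry_mxE //; apply: isometry_comp.
Qed.

Lemma isometry_mx_id : isometry_mx id = 1%:M.
Proof.
apply/row_matrixP => i; rewrite !rowE mulmx1 -isometry_mxE //; exact: isometry_id.
Qed.

End IsometryMatrix.

Section Boundary.
Variables (R : realType) (K : lattice).
Local Notation n := (lrank K).
Local Notation re := (map_mx (@complex.Re R)).
Local Notation im := (map_mx (@complex.Im R)).

Definition complex_act (g : K -> K) (v : 'rV[R[i]]_n) : 'rV[R[i]]_n :=
  v *m map_mx intr (isometry_mx g).

Lemma proj_act_line (g : K -> K) v : proj_act g <[v]>%VS = <[complex_act g v]>%VS.
Proof. by rewrite /proj_act limg_line lfunE. Qed.

Lemma complex_act_comp (g h : K -> K) v : isometry g -> isometry h ->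
  complex_act (g \o h) v = complex_act g (complex_act h v).
Proof. by move=> gi hi; rewrite /complex_act isometry_mx_comp // map_mxM mulmxA. Qed.

Lemma complex_act_id v : complex_act id v = v.
Proof. by rewrite /complex_act isometry_mx_id map_mx1 mulmx1. Qed.

Lemma point_orbit_act (g : K -> K) v : isometry g ->
  point_orbit (proj_act g <[v]>%VS) = point_orbit (<[v]>%VS : proj_point R K).
Proof.
move=> gi; have [g' [g'i gK _]] := isometry_inv gi; apply/seteqP; split=> q [h hi <-].
  exists (h \o g); first exact: isometry_comp.
  by rewrite !proj_act_line complex_act_comp.
exists (h \o g'); first exact: isometry_comp.
rewrite !proj_act_line -complex_act_comp //; last exact: isometry_comp.
by congr (<[complex_act _ _]>%VS); apply/funext => x /=; rewrite gK.
Qed.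

Lemma point_orbit_self v : point_orbit (<[v]>%VS : proj_point R K) <[v]>%VS.
Proof. by exists id; [apply: isometry_id | rewrite proj_act_line complex_act_id]. Qed.

Lemma scalar_ext_act (S : nzRingType) (g : K -> K) (V W : sublattice K) (w : 'rV[S]_n) :
  isometry g -> (forall x, x \in V -> g x \in W) -> scalar_ext S V w ->
  scalar_ext S W (w *m map_mx intr (isometry_mx g)).
Proof.
move=> gi VW [r [b [c [bV ->]]]]; exists r, (b *m isometry_mx g), c; split=> [i|].
  by rewrite row_mul -isometry_mxE //; apply: VW.
by rewrite map_mxM mulmxA.
Qed.


Lemma re_mul_int (p : nat) (v : 'rV[R[i]]_p) (q : nat) (M : 'M[int]_(p, q)) :
  re (v *m map_mx intr M) = re v *m map_mx intr M.
Proof.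
apply/rowP => j; rewrite !mxE raddf_sum; apply: eq_bigr => k _; rewrite !mxE.
by rewrite mulrzr raddfMz mulrzr.
Qed.

Lemma im_mul_int (p : nat) (v : 'rV[R[i]]_p) (q : nat) (M : 'M[int]_(p, q)) :
  im (v *m map_mx intr M) = im v *m map_mx intr M.
Proof.
apply/rowP => j; rewrite !mxE raddf_sum; apply: eq_bigr => k _; rewrite !mxE.
by rewrite mulrzr raddfMz mulrzr.
Qed.

Lemma domain_boundary_line (V : sublattice K) p : domain_boundary R V p ->
  exists v, p = <[v]>%VS.
Proof. by move=> [_ [v [-> _]]]; exists v. Qed.

Lemma complex_act_eq0 (g : K -> K) v : isometry g -> (complex_act g v == 0) = (v == 0).
Proof.
move=> gi; have [h [hi gK _]] := isometry_inv gi.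
apply/eqP/eqP => [v0|->]; last by rewrite /complex_act mul0mx.
have <- : complex_act h (complex_act g v) = v.
  rewrite -complex_act_comp //; have -> : h \o g = id by apply/funext/gK.
  exact: complex_act_id.
by rewrite v0 /complex_act mul0mx.
Qed.

Lemma domain_boundary_act (g : K -> K) (V W : sublattice K) p :
  isometry g -> [set` W] = g @` [set` V] ->
  domain_boundary R V p -> domain_boundary R W (proj_act g p).
Proof.
move=> gi WV [[dp pV] [v [pv Vv]]].
have VW x : x \in V -> g x \in W.
  by move=> xV; have : (g @` [set` V]) (g x) by [exists x]; rewrite -WV.
have [h [hi gK hK]] := isometry_inv gi.
have WV' x : x \in W -> h x \in V.
  move=> xW; have : [set` W] x by [].
  by rewrite WV => -[y yV <-]; rewrite gK.
rewrite pv proj_act_line; split.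
  split; first by rewrite dim_vline complex_act_eq0 // -dim_vline -pv.
  move=> w /vlineP[c ->]; rewrite /complex_act scalemxAl.
  by apply: (scalar_ext_act gi VW); apply: pV; rewrite pv; apply/vlineP; exists c.
exists (complex_act g v); split=> //; rewrite re_mul_int im_mul_int.
apply/seteqP; split=> u.
  move=> /(scalar_ext_act hi WV'); rewrite Vv => -[a [b uE]]; exists a, b.
  rewrite !scalemxAl -mulmxDl -uE -mulmxA -map_mxM -isometry_mx_comp //.
  have -> : g \o h = id by apply/funext/hK.
  by rewrite isometry_mx_id map_mx1 mulmx1.
move=> [a [b ->]]; rewrite !scalemxAl -mulmxDl.
by apply: (scalar_ext_act gi VW); rewrite Vv; exists a, b.
Qed.

Lemma re_scale (c : R[i]) (v : 'rV[R[i]]_n) :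
  re (c *: v) = complex.Re c *: re v - complex.Im c *: im v.
Proof. by apply/rowP => j; rewrite !mxE; case: c => a b; case: (v 0 j). Qed.

Lemma im_scale (c : R[i]) (v : 'rV[R[i]]_n) :
  im (c *: v) = complex.Im c *: re v + complex.Re c *: im v.
Proof. by apply/rowP => j; rewrite !mxE addrC; case: c => a b; case: (v 0 j). Qed.

(** Two representatives of p differ by a complex scalar, so their real and imaginary parts have the
    same real span. Hence V lies in the real span of W, and primitivity of W brings it into W. *)
Lemma domain_boundary_sub (V W : sublattice K) p :
  primitive_sublattice W -> domain_boundary R V p -> domain_boundary R W p ->
  {subset V <= W}.
Proof.
move=> pW [_ [v [pv Vv]]] [_ [w [pw Ww]]] x xV.
apply: (@real_span_integral R) => //; rewrite Ww.
have : scalar_ext R V (map_mx intr (x : 'rV_n)).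
  exists 1%N, (x : 'rV_n), 1%:M; split=> [i|]; last by rewrite mul1mx.
  by rewrite row_id.
rewrite Vv => -[a [b ->]].
have /vlineP[c ->] : v \in <[w]>%VS by rewrite -pw pv memv_line.
exists (a * complex.Re c + b * complex.Im c), (b * complex.Re c - a * complex.Im c).
rewrite re_scale im_scale; apply/rowP => j; rewrite !mxE; ring.
Qed.

Lemma scalar_ext_basis (S : nzRingType) (V : sublattice K) (r : nat) (e : 'M[int]_(r, n)) :
  (forall x : K, x \in V <-> exists c : 'rV[int]_r, x = c *m e) ->
  scalar_ext S V = [set w | exists c : 'rV[S]_r, w = c *m map_mx intr e].
Proof.
move=> eV; apply/seteqP; split=> w; last first.
  move=> [c ->]; exists r, e, c; split=> // i; apply/eV.
  by exists (delta_mx 0 i); rewrite rowE.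
move=> [q [b [c [bV ->]]]].
have /choice[B BE] : forall i, exists d : 'rV[int]_r, row i b = d *m e.
  by move=> i; apply/eV.
exists (c *m map_mx intr (\matrix_i B i)); rewrite -mulmxA -map_mxM; congr (_ *m map_mx _ _).
by apply/row_matrixP => i; rewrite BE row_mul rowK.
Qed.

Lemma domain_boundary_nonempty (V : sublattice K) (r : nat) :
  (r == 1%N) || (r == 2%N) -> has_rank V r -> exists p, domain_boundary R V p.
Proof.
move=> r12 [e [eI eV]].
(* The coordinates are (1) in rank 1 and (1, i) in rank 2, so Re v and Im v are the two basis
   vectors in rank 2, and Im v = 0 in rank 1. *)
pose c : 'rV[R[i]]_r := \row_j (if j == 0%N :> nat then 1 else Complex 0 1).
pose v := c *m map_mx intr e.
have span (d : 'rV[R]_r) : exists a b : R, d = a *: re c + b *: im c.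
  case/orP: r12 => /eqP r_eq; rewrite {}r_eq in d c {v e eI eV} *.
    exists (d ord0 ord0), 0; apply/rowP => j.
    by rewrite !mxE (ord1 j) /= mulr1 mul0r addr0.
  exists (d ord0 ord0), (d ord0 ord_max); apply/rowP => j; rewrite !mxE.
  case: (unliftP ord0 j) => [k ->|->] /=; last by rewrite mulr1 mulr0 addr0.
  by rewrite (ord1 k) mulr0 add0r mulr1; congr (d _ _); apply: val_inj.
have v0 : v != 0.
  (* The real part of v is the first basis vector, which is nonzero by independence over Z. *)
  apply/eqP => v0; pose z : 'rV[int]_r := \row_j (j == 0%N :> nat)%:R.
  have rz : re c = map_mx intr z.
    by apply/rowP => j; rewrite !mxE; case: eqP.
  have /eI/rowP : z *m e = 0.
    have /rowP zE : map_mx (intr : int -> R) (z *m e) = re v.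
      by rewrite map_mxM -rz re_mul_int.
    apply/rowP => j; have := zE j; rewrite v0 [re 0]map_mx0 !mxE => /eqP.
    by rewrite intr_eq0 => /eqP.
  have r_gt0 : (0 < r)%N by case/orP: r12 => /eqP->.
  by move=> /(_ (Ordinal r_gt0)); rewrite !mxE.
exists <[v]>%VS; split.
  split; first by rewrite dim_vline v0.
  move=> w /vlineP[k ->]; rewrite (scalar_ext_basis _ eV); exists (k *: c).
  by rewrite /v scalemxAl.
exists v; split=> //; rewrite (scalar_ext_basis _ eV) !re_mul_int !im_mul_int.
apply/seteqP; split=> u.
  move=> [d ->]; have [a [b ->]] := span d; exists a, b.
  by rewrite mulmxDl !scalemxAl.
by move=> [a [b ->]]; exists (a *: re c + b *: im c); rewrite mulmxDl !scalemxAl.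
Qed.

Definition primitive_isotropic (V : sublattice K) : Prop :=
  primitive_sublattice V /\ isotropic_sublattice V.

Lemma satake_boundaryE (V : sublattice K) : primitive_isotropic V ->
  satake_boundary R V = [set point_orbit p | p in domain_boundary R V].
Proof.
move=> pV; apply/setIidPr => _ [p pV' <-]; exists p => //.
by right; exists V.
Qed.

Lemma satake_boundary_same_orbit (V W : sublattice K) :
  primitive_isotropic V -> primitive_isotropic W -> same_orbit V W ->
  satake_boundary R V = satake_boundary R W.
Proof.
have sub (U U' : sublattice K) : primitive_isotropic U -> primitive_isotropic U' ->
    same_orbit U U' -> satake_boundary R U `<=` satake_boundary R U'.
  move=> pU pU' [g gi gU]; rewrite !satake_boundaryE // => _ [p bp <-].
  exists (proj_act g p); first exact: domain_boundary_act bp.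
  by have [v ->] := domain_boundary_line bp; apply: point_orbit_act.
move=> pV pW VW; apply/seteqP; split; apply: sub => //.
exact: same_orbit_sym.
Qed.

(** A common orbit provides p over V and an isometry g with g p over W. The transported sublattice g
    V and W then share a boundary point, which determines both, so they are equal. *)
Lemma same_orbit_satake_boundary (V W : sublattice K) (r : nat) :
  primitive_isotropic V -> primitive_isotropic W ->
  (r == 1%N) || (r == 2%N) -> has_rank V r ->
  satake_boundary R V = satake_boundary R W -> same_orbit V W.
Proof.
move=> pV pW r12 rV VW; have [p bp] := domain_boundary_nonempty r12 rV.
have : satake_boundary R V (point_orbit p) by rewrite satake_boundaryE //; exists p.
rewrite VW satake_boundaryE // => -[q bq qp].
have [v qv] := domain_boundary_line bq.
have : point_orbit p q by rewrite -qp qv; apply: point_orbit_self.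
move=> [g gi gp]; have [h [hi gK hK]] := isometry_inv gi.
have gV_closed : zmod_closed ((fun x : K => h x \in V) : {pred K}).
  split=> [|x y]; first by change (h 0 \in V); rewrite (isometry0 hi) sublattice0.
  by change (h x \in V -> h y \in V -> h (x - y) \in V); rewrite (isometryB hi); apply: sublatticeB.
pose gV : sublattice K := Sublattice gV_closed.
have in_gV x : (x \in gV) = (h x \in V) by [].
have gVE : [set` gV] = g @` [set` V].
  apply/seteqP; split=> x; first by move=> hx; exists (h x).
  by move=> [y yV <-]; rewrite /= in_gV gK.
have pgV : primitive_sublattice gV.
  by move=> k x k0; rewrite !in_gV (isometryMz k hi); apply: (pV.1 k).
have bgV : domain_boundary R gV q by rewrite -gp; apply: domain_boundary_act bp.
exists g => //; rewrite -gVE; apply/seteqP; split=> x.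
  exact: (domain_boundary_sub pgV bq bgV).
exact: (domain_boundary_sub pW.1 bgV bq).
Qed.

End Boundary.

(** The maps o and s have the same fibres on D, so their images are two forms of one quotient of D.
    Off the image of o the value chosen is the empty set. *)
Lemma quotient_bijection (T A U : Type) (D : set T) (o : T -> A) (s : T -> set U) :
  (forall x y, D x -> D y -> o x = o y <-> s x = s y) ->
  exists f : A -> set U, set_bij (o @` D) (s @` D) f /\ forall x, D x -> f (o x) = s x.
Proof.
move=> os.
have /choice[f fP] : forall a, exists b, forall x, D x -> o x = a -> s x = b.
  move=> a; have [[x Dx <-]|na] := pselect (exists2 x, D x & o x = a).
    by exists (s x) => y Dy /os; apply.
  by exists set0 => x Dx xa; case: na; exists x.
have fE x : D x -> f (o x) = s x by move=> Dx; rewrite (fP (o x) x).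
exists f; split=> //; split.
- by move=> _ [x Dx <-]; rewrite fE //; exists x.
- move=> _ _ /set_mem[x Dx <-] /set_mem[y Dy <-]; rewrite !fE // => sxy.
  by apply/os.
- by move=> _ [x Dx <-]; exists (o x); [exists x | apply: fE].
Qed.

Lemma card_eq_pair (A U : Type) (a b : A) (S : set A) (S' : set (set U)) (f : A -> set U) :
  S = [set a; b] -> a <> b -> set_bij S S' f -> S' #= `I_2.
Proof.
move=> -> ab [fS fI fs]; rewrite card_eq_sym; apply/card_set_bijP.
have inj : f a <> f b.
  by move=> fab; apply: ab; apply: fI fab; rewrite inE; [left | right].
exists (fun i : nat => f (if i == 0%N then a else b)); split.
- by move=> [|[|//]] _; apply: fS; [left | right].
- have lt2 k : k \in `I_2 -> (k < 2)%N by rewrite inE.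
  by move=> [|[|k]] [|[|l]] /lt2 k2 /lt2 l2 //= /esym/inj.
- by move=> _ /fs[_ [->|->] <-]; [exists 0%N | exists 1%N].
Qed.

Section Components.
Variables (R : realType) (K : lattice).
Hypothesis hK : isometric K (Ipm 2 10).

Lemma zspanP (v x : K) : x \in zspan v <-> exists k : int, x = k *: (v : 'rV_(lrank K)).
Proof.
split=> [/asboolP[k ->]|[k ->]]; first by exists k; rewrite -scaler_int intz.
by apply/asboolP; exists k; rewrite -scaler_int intz.
Qed.

(** A vector y with <y|v> = 1 reads off the coefficient: if a nonzero multiple of x lies on the line
    of v, then x = <y|x> v. *)
Lemma zspan_primitive_isotropic (v : K) :
  primitive_isotropic_vector K v -> primitive_isotropic (zspan v).
Proof.
have [g gi] := hK => pv; have [v0 vv _] := pv.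
split=> [k x k0 /zspanP[l xk]|x y /zspanP[k ->] /zspanP[l ->]]; last first.
  by rewrite lformZl lformZr vv !mulr0.
have [_ _ /(primitive_dual (Ipm_unimodular 2 10))[y yv]] := primitive_isotropic_isometry gi pv.
have [h [hi gK hK']] := isometry_inv gi; case: (gi) => _ _ gf.
rewrite -[y]hK' gf in yv.
apply/zspanP; exists <| h y, x |>; apply: (int_scalerI k0).
rewrite scalerA -lformZr; have {}xk : k *: (x : 'rV_(lrank K)) = l *: (v : 'rV_(lrank K)).
  by rewrite -xk -scaler_int intz.
by rewrite xk lformZr yv mulr1.
Qed.

Lemma zspan_rank (v : K) : v != 0 -> has_rank (zspan v) 1.
Proof.
move=> v0; exists (v : 'rV_(lrank K)); split=> [c|x].
  rewrite (mx11_scalar c) mul_scalar_mx => cv.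
  have [->|c0] := eqVneq (c 0 0) 0; first by rewrite raddf0.
  by case/eqP: v0; apply: (int_scalerI c0); rewrite cv scaler0.
rewrite zspanP; split=> [[k ->]|[c ->]]; first by exists k%:M; rewrite mul_scalar_mx.
by exists (c 0 0); rewrite {1}(mx11_scalar c) mul_scalar_mx.
Qed.

(** A primitive generator of the line is unique up to sign, and -1 is an isometry. *)
Lemma zspan_same_orbit (v w : K) :
  primitive_isotropic_vector K v ->
  same_orbit (zspan v) (zspan w) <-> equivalent v w.
Proof.
move=> pv; split=> [[g gi gvw]|[g gi gv]].
  have : (g @` [set` zspan v]) (g v).
    by exists v => //; apply/zspanP; exists 1; rewrite scale1r.
  rewrite -gvw => /zspanP[k gE].
  have gv : equivalent v (g v) by exists g.
  have [_ _ /(_ k w)] := primitive_isotropic_isometry gi pv.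
  rewrite -scaler_int intz => /(_ gE).
  case: (ger0P k) gE => _ gE kE; first by rewrite gE kE scale1r in gv.
  apply: (equivalent_trans gv); rewrite gE -[k]opprK kE scaleN1r.
  exact/equivalent_sym/equivalent_opp.
exists g => //; apply/seteqP; split=> x.
  by move=> /zspanP[k ->]; exists (k *: (v : 'rV_(lrank K)));
    [apply/zspanP; exists k | rewrite (isometryZ _ _ gi) gv].
by move=> [_ /zspanP[k ->] <-]; apply/zspanP; exists k; rewrite (isometryZ _ _ gi) gv.
Qed.

Lemma rank1_zspan (V : sublattice K) :
  primitive_sublattice V -> isotropic_sublattice V -> has_rank V 1 ->
  exists2 v, primitive_isotropic_vector K v & same_orbit V (zspan v).
Proof.
move=> pV iV [v [vI vV]].
have vk (k : int) : k *: v = 0 -> k = 0.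
  by rewrite -mul_scalar_mx => /vI/rowP/(_ ord0); rewrite !mxE.
have Vv : (v : K) \in V by apply/vV; exists 1%:M; rewrite mul1mx.
exists v; last first.
  exists id; first exact: isometry_id.
  rewrite image_id; apply/seteqP; split=> x.
    by move=> /zspanP[k ->]; apply/vV; exists k%:M; rewrite mul_scalar_mx.
  by move=> /vV[c ->]; apply/zspanP; exists (c 0 0); rewrite {1}(mx11_scalar c) mul_scalar_mx.
split.
- by apply/eqP => v0; have := vk 1; rewrite scale1r => /(_ v0).
- exact: iV.
- move=> k w; rewrite -scaler_int intz => vw.
  have k0 : k != 0.
    by apply/eqP => k0; have := vk 1; rewrite scale1r {1}vw k0 scale0r => /(_ erefl).
  have /vV[c wE] : w \in V by apply: (pV k) => //; rewrite -scaler_int intz -vw.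
  rewrite (mx11_scalar c) mul_scalar_mx in wE.
  apply: (@mul_eq1_norm k (c 0 0)); apply/eqP; rewrite eq_sym -subr_eq0; apply/eqP/vk.
  by rewrite scalerBl scale1r -scalerA -wE -vw subrr.
Qed.

Lemma boundary_components0 :
  boundary_components R K 0 =
  [set satake_boundary R (zspan v) | v in primitive_isotropic_vector K].
Proof.
apply/seteqP; split=> [_ [V [pV iV rV] <-]|_ [v pv <-]].
  have [v pv Vv] := rank1_zspan pV iV rV; exists v => //.
  apply/satake_boundary_same_orbit/same_orbit_sym => //.
  exact: zspan_primitive_isotropic.
have [p i] := zspan_primitive_isotropic pv; exists (zspan v) => //; split=> //.
by apply: zspan_rank; case: pv.
Qed.

End Components.

Theorem corollary4 (R : realType) (K : lattice) (hK : isometric K (Ipm 2 10)) :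
  (exists v0 v1 : K,
    [/\ primitive_isotropic_vector K v0
          /\ isometric (perp_quot (zspan v0)) (Ipm 1 9),
        primitive_isotropic_vector K v1
          /\ isometric (perp_quot (zspan v1)) II_1_9,
        vector_orbit v0 <> vector_orbit v1,
        isotropic_vector_orbits K = [set vector_orbit v0; vector_orbit v1]
      & boundary_components R K 0 #= `I_2 /\
        exists f : set K -> set (set (proj_point R K)),
          set_bij (isotropic_vector_orbits K) (boundary_components R K 0) f /\
          forall v : K, primitive_isotropic_vector K v ->
            f (vector_orbit v) = satake_boundary R (zspan v)])
  /\
  (exists V0 V1 : sublattice K,
    [/\ primitive_isotropic_plane K V0
          /\ isometric (perp_quot V0) (lattice_neg E8),
        primitive_isotropic_plane K V1
          /\ isometric (perp_quot V1) (Ipm 0 8),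
        sublattice_orbit V0 <> sublattice_orbit V1,
        isotropic_plane_orbits K = [set sublattice_orbit V0; sublattice_orbit V1]
      & boundary_components R K 1 #= `I_2 /\
        exists f : set (sublattice K) -> set (set (proj_point R K)),
          set_bij (isotropic_plane_orbits K) (boundary_components R K 1) f /\
          forall V : sublattice K, primitive_isotropic_plane K V ->
            f (sublattice_orbit V) = satake_boundary R V]).
Proof.
split.
  have [v0 [v1 [pv0 pv1 v01 vE]]] := isotropic_vector_classification hK.
  (* Orbits of vectors and boundary components are both quotients of the set of primitive isotropic
     vectors by one relation, equivalence of the lines they span. *)
  have [v w pv pw|f [fb fE]] := @quotient_bijection _ _ _ (primitive_isotropic_vector K)
      (@vector_orbit K) (fun v => satake_boundary R (zspan v)).
    have sv := zspan_primitive_isotropic hK pv; have sw := zspan_primitive_isotropic hK pw.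
    rewrite vector_orbitP -zspan_same_orbit //.
    split; first exact: satake_boundary_same_orbit.
    by apply: (@same_orbit_satake_boundary R K _ _ 1) => //; apply: zspan_rank; case: pv.
  rewrite -boundary_components0 // in fb.
  exists v0, v1; split=> //; split; last by exists f.
  exact: card_eq_pair vE v01 fb.
have [V0 [V1 [pV0 pV1 V01 VE]]] := isotropic_plane_classification hK.
have [V W [pV iV rV] [pW iW _]|f [fb fE]] := @quotient_bijection _ _ _
    (primitive_isotropic_plane K) (@sublattice_orbit K) (@satake_boundary R K).
  rewrite sublattice_orbitP; split; first exact: satake_boundary_same_orbit.
  exact: (@same_orbit_satake_boundary R K _ _ 2).
exists V0, V1; split=> //; split; last by exists f.
exact: card_eq_pair VE V01 fb.
Qed.
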